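(* Let $G=(V,E)$ be a finite graph whose maximal degree is at most $K\in\mathbb N$, let $\beta>0$, $\theta>0$ and $u\in(0,1]$, and let $\mathbb P$ be the random loop measure on $G$ with parameters $(\beta,u,\theta)$ (defined in the context). Put $\hat\theta=\max\{\theta,1/\theta\}$, $\check\theta=\min\{\theta,1/\theta\}$ and \[ \delta(\beta,u,\theta)=\frac{1}{2}\left(\frac{u\check\theta}{K}\right)^2\frac{\beta\check\theta^3}{\beta\check\theta^3+3\cdot 4^{K+1}}\left(\frac{\beta\hat\theta}{e^{\beta\hat\theta}-1}\right)^{2K-1}. \] Then for every subset $\tilde E\subseteq E$ the following holds. Under $\mathbb P$ conditioned on the event that $N_e\ge 1$ for every $e\in\tilde E$ and $N_e=0$ for every $e\in E\setminus\tilde E$, the random vector $(B_e)_{e\in\tilde E}$ of blocking-edge indicators stochastically dominates Bernoulli edge percolation on $\tilde E$ with parameter $\delta(\beta,u,\theta)$. That is, there is a coupling of the two such that, almost surely, every edge of $\tilde E$ that is open in the Bernoulli percolation is blocking.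
   Context: A link configuration on a finite graph $G=(V,E)$ is a finite sequence $c=(e_i,s_i)_{i\le n}$ with $n\in\mathbb N_0$, $e_i\in E$ and $s_i\in\{-1,1\}$. A pair with $s_i=1$ is a ''cross'' and a pair with $s_i=-1$ is a ''double bar''. Let $N_e(c)=|\{i:e_i=e\}|$. Loops: place the $i$-th link at time $t_i=i/(n+1)$ on the edge $e_i$. Consider $V\times[0,1)$, where $[0,1)$ is viewed as a circle (periodic time). A loop is traced by moving in time along $\{v\}\times[0,1)$. When the trajectory meets a time $t_i$ with $v\in e_i$, it jumps to the other endpoint $w$ of $e_i$. After a cross it continues in the same time direction, and after a double bar it reverses the time direction. The closed trajectories obtained in this way are the loops of $c$, and $|\mathcal L(c)|$ denotes their number. Random loop measure: for $\theta=1$, draw independent $\mathrm{Poisson}(\beta)$ numbers of links $N_e$ for each $e\in E$. Order the resulting multiset of $n=\sum_e N_e$ edges by a uniformly random permutation, and give each link independently type $s_i=1$ with probability $u$ and $s_i=-1$ otherwise. Equivalently, a configuration $c$ of length $n$ has probability proportional to $\frac{\beta^n}{n!}u^{\#\text{crosses}}(1-u)^{\#\text{double bars}}$. For general $\theta>0$, this measure is reweighted by $\theta^{|\mathcal L(c)|}$ and normalised. Blocking edge: an edge $e$ is blocking in $c$, written $B_e(c)=1$ (and $B_e(c)=0$ otherwise), if all of the following hold: (i) $N_e(c)=2$; (ii) both links on $e$ are crosses; (iii) if $i<j$ are the two indices with $e_i=e_j=e$, then every $k$ with $i<k<j$ satisfies $e_k\cap e=\emptyset$. *)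

(* Defs.v *)
From HB Require Import structures.
From mathcomp Require Import all_boot all_order all_algebra.
From mathcomp Require Import all_classical all_reals all_analysis.
Set Implicit Arguments. Unset Strict Implicit. Unset Printing Implicit Defensive.
Import Order.TTheory GRing.Theory Num.Theory.
Import numFieldNormedType.Exports.
Local Open Scope ring_scope.

Section RandomLoops.
Variable V : finType.

(* A link: an edge (a 2-element set of vertices) and its type;
   true = cross (s_i = 1), false = double bar (s_i = -1). *)
Definition link := ({set V} * bool)%type.
Definition config := seq link.

Definition dummy_link : link := (finset.set0, true).

Definition Nlinks (c : config) (e : {set V}) : nat := count (fun l => l.1 == e) c.

Definition other (e : {set V}) (v : V) : V := odflt v [pick w in e :\ v].

(* Loops.  With n = size c, the link with (0-based) index i sits at time
   (i+1)/(n+1).  For each vertex v, the "gap" j : 'I_(n+1) is the open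
   time interval between the (j)-th and (j+1)-th link times (1-based), with
   time 0 and time 1 = (n+1)/(n+1) as artificial boundaries; gap n and gap 0
   are glued through time 1 = 0.  stepU x is the gap reached when leaving x
   upwards in time, stepD x the gap reached when leaving x downwards. *)
Definition stepU (c : config) (x : V * 'I_(size c).+1) : V * 'I_(size c).+1 :=
  let: (v, j) := x in
  if (j : nat) == size c then (v, inord 0) else
  let: (e, s) := nth dummy_link c j in
  if v \in e then
    (if s then (other e v, inord j.+1) else (other e v, j))
  else (v, inord j.+1).

Definition stepD (c : config) (x : V * 'I_(size c).+1) : V * 'I_(size c).+1 :=
  let: (v, j) := x in
  if (j : nat) == 0%N then (v, inord (size c)) else
  let: (e, s) := nth dummy_link c j.-1 in
  if v \in e then
    (if s then (other e v, inord j.-1) else (other e v, j))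
  else (v, inord j.-1).

Definition gap_adj (c : config) : rel (V * 'I_(size c).+1) :=
  fun x y => [|| stepU x == y, stepD x == y, stepU y == x | stepD y == x].

Definition nloops (c : config) : nat :=
  #|[set [set y | connect (@gap_adj c) x y] | x : V * 'I_(size c).+1]|.

Definition blocking (c : config) (e : {set V}) : bool :=
  [&& Nlinks c e == 2%N,
      all (fun l => (l.1 == e) ==> l.2) c &
      [forall i : 'I_(size c), forall j : 'I_(size c), forall k : 'I_(size c),
         [&& (nth dummy_link c i).1 == e, (nth dummy_link c j).1 == e,
             (i < k)%N & (k < j)%N] ==>
         ((nth dummy_link c k).1 :&: e == finset.set0)]].

Variable R : realType.

Definition loop_weight (beta u theta : R) (c : config) : R :=
  beta ^+ size c / (size c)`!%:R
  * u ^+ count (fun l : link => l.2) c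
  * (1 - u) ^+ count (fun l : link => ~~ l.2) c
  * theta ^+ nloops c.

Definition cond_event (Et : {set {set V}}) (c : config) : bool :=
  all (fun l : link => l.1 \in Et) c && [forall e in Et, (0 < Nlinks c e)%N].

Definition sum_configs (f : config -> R) : R :=
  limn (series (fun n => \sum_(c : n.-tuple link) f c)).

Definition cond_loop_prob (beta u theta : R) (Et : {set {set V}}) (c : config) : R :=
  (loop_weight beta u theta c * (cond_event Et c)%:R)
  / sum_configs (fun c' => loop_weight beta u theta c' * (cond_event Et c')%:R).

Definition bernoulli_perc (p : R) (Et : {set {set V}}) (w : {set {set V}}) : R :=
  if w \subset Et then p ^+ #|w| * (1 - p) ^+ (#|Et| - #|w|) else 0.

End RandomLoops.

Definition delta_const (R : realType) (K : nat) (beta u theta : R) : R :=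
  let th := Num.max theta theta^-1 in
  let tc := Num.min theta theta^-1 in
  2^-1 * (u * tc / K%:R) ^+ 2
  * (beta * tc ^+ 3 / (beta * tc ^+ 3 + 3 * 4 ^+ K.+1))
  * (beta * th / (expR (beta * th) - 1)) ^+ (2 * K - 1).

(* Main.v *)
(* Stochastic domination follows, by revealing the edges one after the other,
   from a one-edge inequality: for e in Et and any prescribed set b of blocking
   edges among the others, the configurations with blocking set b + e carry at
   least a fraction delta of the weight of those with blocking set b off e.
   Two facts about loops drive the weight estimates: one link changes the number
   of loops by at most one (it multiplies a permutation by two transpositions),
   and the two crosses of a blocking edge can be deleted without changing it.
   Write y = beta max(theta, 1/theta) and let Z be the weight of the
   configurations without links on e and with blocking set exactly b.
   - Deleting all links on e costs e^y - 1.  It can turn edges adjacent to e into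
     blocking ones; each of these loses one of its crosses, at cost 1 + y/2 per
     adjacent edge.  This bounds the total weight by (e^y - 1)(1 + y/2)^(2K-2) Z.
   - Two crosses on e, inserted in slots that have no link touching e between
     them and lie outside the crosses of every blocking neighbour, make e blocking
     and disturb no other edge.  A uniform slot lies outside all neighbours with
     probability at least 1/(4K-3): otherwise exchange it with the second cross of
     the neighbour covering it and iterate.  The expected number of links touching
     e is O(K(K + y)), because all but 2K-2 links of a non-blocking edge with at
     least four links can be removed without affecting any blocking status.
     Cauchy-Schwarz then bounds from below the weight of the insertions. *)
Require Import Defs.
From HB Require Import structures.
From mathcomp Require Import all_boot all_order all_algebra all_fingroup.
From mathcomp Require Import zify.
Set Implicit Arguments. Unset Strict Implicit. Unset Printing Implicit Defensive.

(** * Loops as connected components *)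

Section Components.

(** The obstacle is that the prescribed blocking pattern of the other edges is arbitrary: changing
    the links on [e] may create or destroy blocking edges around it. Both sides of the one-edge
    inequality are therefore compared with a common reference, the configurations without links on
    [e]. The upper estimates are Mecke inequalities for Poisson processes: pairs (configuration,
    link) are injected into triples (configuration, slot, type), and each removed link may cost a
    factor max(theta, 1/theta). Inserting a blocking pair has an exact weight, because the number of
    loops stays the same. This explains [delta_const]. One factor y/(e^y - 1) pays for the deletion
    on [e]; the other 2K-2 absorb the power (1 + y/2)^(2K-2) together with the linear growth in y of
    the expected number of links touching [e]. What remains is a polynomial in K, dominated by 3 *
    4^(K+1) times K^2. All inequalities are proved for configurations of bounded length and pass to
    the limit at the end. *)

Definition ncomps (T : finType) (e : rel T) : nat :=
  #|[set [set y | connect e x y] | x : T]|.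

(** The components of [X] are the preimages of those of [Y], and taking preimages under a surjection
    is injective. *)
Lemma ncomps_map (X Y : finType) (eX : rel X) (eY : rel Y) (h : X -> Y) :
  (forall y, exists x, h x = y) ->
  (forall x x', connect eX x x' = connect eY (h x) (h x')) ->
  ncomps eX = ncomps eY.
Proof.
move=> hsurj hconn; rewrite /ncomps.
set CY := [set [set y' | connect eY y y'] | y : Y].
have -> : [set [set y | connect eX x y] | x : X] = [set h @^-1: B | B : {set Y} in CY].
  apply/setP => A; apply/imsetP/imsetP => [[x _ ->]|[_ /imsetP[y _ ->] ->]].
    exists [set y | connect eY (h x) y]; first exact: imset_f.
    by apply/setP => x'; rewrite !inE hconn.
  have [x <-] := hsurj y; exists x => //.
  by apply/setP => x'; rewrite !inE hconn.
rewrite card_in_imset // => B B' _ _ /setP eqB; apply/setP => y.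
by have [x <-] := hsurj y; have := eqB x; rewrite !inE.
Qed.

End Components.

Section Loops.
Variable V : finType.
Implicit Types (N i : nat) (l : nat -> link V).

(** The number [N] of links is kept apart from the link sequence, so that two sequences can be
    compared on one type of gaps; in [stepU] that type depends on the configuration. *)
Definition up N l (x : V * 'I_N.+1) : V * 'I_N.+1 :=
  let: (v, j) := x in
  if (j : nat) == N then (v, inord 0) else
  let: (e, s) := l j in
  if v \in e then
    (if s then (other e v, inord j.+1) else (other e v, j))
  else (v, inord j.+1).

Definition down N l (x : V * 'I_N.+1) : V * 'I_N.+1 :=
  let: (v, j) := x in
  if (j : nat) == 0%N then (v, inord N) else
  let: (e, s) := l j.-1 in
  if v \in e then
    (if s then (other e v, inord j.-1) else (other e v, j))
  else (v, inord j.-1).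

Definition adj N l : rel (V * 'I_N.+1) :=
  fun x y => [|| up l x == y, down l x == y, up l y == x | down l y == x].

Lemma nloopsE (c : config V) :
  nloops c = ncomps (@adj (size c) (nth (dummy_link V) c)).
Proof. by []. Qed.

Lemma adj_sym N l : connect_sym (@adj N l).
Proof.
apply: sym_connect_sym => x y; rewrite /adj.
by case: (up l x == y); case: (down l x == y); case: (up l y == x);
   case: (down l y == x).
Qed.

Lemma adj_up N l x : adj l x (@up N l x).
Proof. by rewrite /adj eqxx. Qed.

Lemma adj_down N l x : adj l x (@down N l x).
Proof. by rewrite /adj eqxx orbT. Qed.

Lemma connect_homo N (l : nat -> link V) (T : finType) (e : rel T)
    (h : V * 'I_N.+1 -> T) : connect_sym e ->
  (forall x, connect e (h x) (h (up l x))) ->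
  (forall x, connect e (h x) (h (down l x))) ->
  forall x y, connect (@adj N l) x y -> connect e (h x) (h y).
Proof.
move=> esym hu hd x y /connectP[p]; elim: p x => [|z p IH] x /=.
  by move=> _ ->; exact: connect0.
move=> /andP[xz zp] ey; apply: connect_trans (IH z zp ey).
by case/or4P: xz => /eqP <-; rewrite ?hu ?hd // esym ?hu ?hd.
Qed.

(** * Deleting a null link *)

Definition squeeze N i (x : V * 'I_N.+2) : V * 'I_N.+1 :=
  (x.1, inord (if (x.2 <= i)%N then x.2 : nat else x.2.-1)).

Lemma pair_ordP N (x y : V * 'I_N.+1) :
  x.1 = y.1 -> x.2 = y.2 :> nat -> x = y.
Proof. by case: x y => [v j] [w k] /= -> /val_inj ->. Qed.

Section Null.
Variables (N i : nat) (l l' : nat -> link V).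
Hypotheses (iN : (i <= N)%N) (l'i : l' i = dummy_link V).
Hypotheses (l'lt : forall j, (j < i)%N -> l' j = l j).
Hypotheses (l'ge : forall j, (i <= j)%N -> l' j.+1 = l j).

Let h := @squeeze N i.

Let up_i (x : V * 'I_N.+2) : x.2 = i :> nat -> up l' x = (x.1, inord i.+1).
Proof.
case: x => v j /= ji; rewrite ji l'i /= finset.in_set0.
by have -> : (i == N.+1) = false by lia.
Qed.

Let up_null (x : V * 'I_N.+2) : x.2 = i :> nat -> h (up l' x) = h x.
Proof.
move=> ji; rewrite up_i //; apply: pair_ordP; rewrite //= ji leqnn.
have -> : (inord i.+1 : 'I_N.+2) = i.+1 :> nat by rewrite inordK; lia.
by rewrite ltnn.
Qed.

Let down_null (x : V * 'I_N.+2) : x.2 = i.+1 :> nat -> h (down l' x) = h x.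
Proof.
case: x => v j /= ji; rewrite ji /= l'i /= finset.in_set0; apply: pair_ordP => //=.
have -> : (inord i : 'I_N.+2) = i :> nat by rewrite inordK; lia.
by rewrite ji leqnn ltnn.
Qed.

Let hE v k : (k < N.+2)%N -> h (v, inord k) = (v, inord (if (k <= i)%N then k else k.-1)).
Proof. by move=> kN; rewrite /h /squeeze /= inordK. Qed.

Let up_other (x : V * 'I_N.+2) : x.2 <> i :> nat -> h (up l' x) = up l (h x).
Proof.
case: x => v j /= ji; have ltj := ltn_ord j.
rewrite /= inordK; last by case: ifP; lia.
have lE : l' j = l (if (j <= i)%N then j : nat else j.-1).
  case: ifP => [jle|jle]; first by rewrite l'lt //; lia.
  by rewrite -l'ge ?prednK //; lia.
have -> : ((if (j <= i)%N then j : nat else j.-1) == N) = (j == N.+1 :> nat).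
  by case: ifP; lia.
case: ifP => [_|jN]; first by rewrite hE.
rewrite lE; case: (l _) => e s.
by case: ifP => ve; case: s; rewrite // hE ?ltnS; try lia;
  congr (_, inord _); do 2![case: ifP]; lia.
Qed.

Let down_other (x : V * 'I_N.+2) : x.2 <> i.+1 :> nat ->
  h (down l' x) = down l (h x).
Proof.
case: x => v j /= ji; have ltj := ltn_ord j.
rewrite /= inordK; last by case: ifP; lia.
have lE : j <> 0 :> nat -> l' j.-1 = l (if (j <= i)%N then j : nat else j.-1).-1.
  move=> j0; case: ifP => [jle|jle]; first by rewrite l'lt //; lia.
  by rewrite -l'ge ?prednK //; lia.
have -> : ((if (j <= i)%N then j : nat else j.-1) == 0)%N = (j == 0 :> nat).
  by case: ifP; lia.
case: ifP => [_|j0].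
  by rewrite hE //; congr (_, inord _); case: ifP; lia.
rewrite lE; last by lia.
case: (l _) => e s.
by case: ifP => ve; case: s; rewrite // hE ?ltnS; try lia;
  congr (_, inord _); do 2![case: ifP]; lia.
Qed.

Let surj_neq k (y : V * 'I_N.+1) : (k = i \/ k = i.+1) ->
  exists2 x : V * 'I_N.+2, x.2 <> k :> nat & h x = y.
Proof.
case: y => v j hk; have := ltn_ord j => ltj.
exists (v, inord (if (j < k)%N then j : nat else j.+1)).
  by rewrite /= inordK; case: ifP; lia.
rewrite hE; last by case: ifP; lia.
by apply: pair_ordP => //=; rewrite inordK; do 2![case: ifP]; lia.
Qed.

Let fiber (x x' : V * 'I_N.+2) : h x = h x' -> connect (adj l') x x'.
Proof.
have null v (a b : 'I_N.+2) : a = i :> nat -> b = i.+1 :> nat ->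
    connect (adj l') (v, a) (v, b).
  move=> ai bi; apply: connect1; suff -> : (v, b) = up l' (v, a) by exact: adj_up.
  by rewrite up_i //; apply: pair_ordP => //=; rewrite bi inordK //; lia.
case: x x' => [v j] [w k] []; rewrite /= => <- /(congr1 val) /=.
have := ltn_ord j; have := ltn_ord k => ltk ltj.
rewrite !inordK; try (case: ifP; lia); move=> jk.
have [/val_inj ->|[[ji ki]|[ji ki]]] : (j = k :> nat) \/
    ((j = i :> nat /\ k = i.+1 :> nat) \/ (j = i.+1 :> nat /\ k = i :> nat)).
  by case: ifP jk; case: ifP; lia.
- exact: connect0.
- exact: null.
- by rewrite adj_sym; exact: null.
Qed.

(** [squeeze] merges gaps [i] and [i.+1], which the null link separates. It commutes with [up]
    except at gap [i] and with [down] except at gap [i.+1], and there the step stays inside a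
    fibre. *)
Lemma ncomps_null : ncomps (@adj N.+1 l') = ncomps (@adj N l).
Proof.
apply: (@ncomps_map _ _ _ _ h) => [y|x x'].
  by have [x _ <-] := @surj_neq i y (or_introl erefl); exists x.
apply/idP/idP.
  move: x x'; apply: connect_homo => //; first exact: adj_sym.
    move=> x; have [xi|xi] := eqVneq (x.2 : nat) i.
      by rewrite up_null // connect0.
    by rewrite up_other; [apply/connect1/adj_up | exact/eqP].
  move=> x; have [xi|xi] := eqVneq (x.2 : nat) i.+1.
    by rewrite down_null // connect0.
  by rewrite down_other; [apply/connect1/adj_down | exact/eqP].
have pick y : exists x, h x == y.
  by have [x0 _ <-] := @surj_neq i y (or_introl erefl); exists x0.
pose s y := xchoose (pick y).
have sK y : h (s y) = y by apply/eqP; exact: (xchooseP (pick y)).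
(* Fibres are connected, so representatives may be switched freely: one off gap [i] serves for [up],
   one off gap [i.+1] for [down]. *)
have lift y y' : connect (adj l) y y' -> connect (adj l') (s y) (s y').
  move: y y'; apply: connect_homo => //; first exact: adj_sym.
    move=> y; have [z zi zy] := @surj_neq i y (or_introl erefl).
    apply: (@connect_trans _ _ z); first by apply: fiber; rewrite sK.
    apply: (@connect_trans _ _ (up l' z)); first exact/connect1/adj_up.
    by apply: fiber; rewrite sK up_other // zy.
  move=> y; have [z zi zy] := @surj_neq i.+1 y (or_intror erefl).
  apply: (@connect_trans _ _ z); first by apply: fiber; rewrite sK.
  apply: (@connect_trans _ _ (down l' z)); first exact/connect1/adj_down.
  by apply: fiber; rewrite sK down_other // zy.
move=> /lift hxx; apply: connect_trans (connect_trans hxx _).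
  by apply: fiber; rewrite sK.
by apply: fiber; rewrite sK.
Qed.

End Null.

(* The dummy link sits on the empty edge: it splits a gap and moves nothing. *)
Lemma nloops_null (a z : config V) :
  nloops (a ++ dummy_link V :: z) = nloops (a ++ z).
Proof.
rewrite !nloopsE (_ : size (a ++ dummy_link V :: z) = (size (a ++ z)).+1);
  last by rewrite !size_cat /= addnS.
apply: (@ncomps_null _ (size a)).
- by rewrite size_cat leq_addr.
- by rewrite nth_cat ltnn subnn.
- by move=> j ja; rewrite !nth_cat ja.
- by move=> j ja; rewrite !nth_cat !ltnNge ja (leqW ja) /= subSn.
Qed.

End Loops.

(** * Cancelling two crosses on one edge *)

Section Swap.
Variable V : finType.
Implicit Types (e f : {set V}) (v w : V).

Lemma other_in e v : v \in e -> other e v \in e.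
Proof.
by move=> ve; rewrite /other; case: pickP => //= w; rewrite !inE => /andP[].
Qed.

Lemma other_neq e v : #|e| = 2 -> v \in e -> other e v != v.
Proof.
move=> e2 ve; rewrite /other; case: pickP => /= [w|e0]; first by rewrite !inE => /andP[].
by have := cardsD1 v e; rewrite ve e2 (eq_card0 e0).
Qed.

Lemma otherK e v : #|e| = 2 -> v \in e -> other e (other e v) = v.
Proof.
move=> e2 ve; have oe := other_in ve; have on := other_neq e2 ve.
apply/eqP/negPn/negP => oo.
have := other_neq e2 oe => ooo; have ooe := other_in oe.
have us : uniq [:: v; other e v; other e (other e v)].
  by rewrite /= !inE eq_sym negb_or on eq_sym oo eq_sym ooo.
suff : (3 <= #|e|)%N by rewrite e2.
rewrite cardE; apply: (uniq_leq_size us) => x.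
by rewrite mem_enum !inE => /or3P[] /eqP ->.
Qed.

Definition swap f v := if v \in f then other f v else v.

Lemma swapK f : #|f| = 2 -> involutive (swap f).
Proof.
move=> f2 v; rewrite /swap; case: (boolP (v \in f)) => vf.
  by rewrite other_in // otherK.
by rewrite (negPf vf).
Qed.

Lemma swap_fix f v : v \notin f -> swap f v = v.
Proof. by move=> vf; rewrite /swap (negPf vf). Qed.

Lemma swap_disjoint f e v : e :&: f = set0 -> v \in e -> v \notin f.
Proof.
by move=> ef ve; apply/negP => vf; move/setP/(_ v): ef; rewrite !inE ve vf.
Qed.

Lemma swap_mem f e v : e :&: f = set0 -> (swap f v \in e) = (v \in e).
Proof.
move=> ef; rewrite /swap; case: ifP => // vf.
have noe w : w \in f -> w \in e = false.
  by move=> wf; apply/negP => /(swap_disjoint ef); rewrite wf.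
by rewrite !noe // other_in.
Qed.

End Swap.

Section Pair.
Variables (V : finType) (f : {set V}) (N i k : nat) (l l' : nat -> link V).
Hypotheses (f2 : #|f| = 2) (ik : (i < k)%N) (kN : (k < N)%N).
Hypotheses (li : l i = (f, true)) (lk : l k = (f, true)).
Hypotheses (l'i : l' i = dummy_link V) (l'k : l' k = dummy_link V).
Hypothesis l'E : forall j, j != i -> j != k -> l' j = l j.
Hypothesis lmid : forall j, (i < j < k)%N -> (l j).1 :&: f = set0.

(** Relabels the vertices between the two crosses by exchanging the endpoints of [f]. The links
    there avoid [f] and commute with the exchange, and at both ends the relabelling absorbs a cross;
    so [sg] conjugates the steps of [l] to those of [l']. *)
Let sg (x : V * 'I_N.+1) : V * 'I_N.+1 :=
  (if (i < x.2 <= k)%N then swap f x.1 else x.1, x.2).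

Let sgK : involutive sg.
Proof.
by move=> [v j]; rewrite /sg /=; case: ifP => mid; rewrite mid ?swapK.
Qed.

Let sgE v m : (m <= N)%N ->
  sg (v, inord m) = (if (i < m <= k)%N then swap f v else v, inord m).
Proof. by move=> mN; rewrite /sg /= inordK. Qed.

Let up_l (x : V * 'I_N.+1) : sg (up l x) = up l' (sg x).
Proof.
case: x => v j; have ltj := ltn_ord j.
rewrite /=; case: ifP => [jN|jN].
  by rewrite sgE // (_ : (i < j <= k)%N = false) //; lia.
have [ji|ji] := eqVneq (j : nat) i.
  rewrite ji li l'i /= finset.in_set0 ltnn /=.
  have -> : (if v \in f then (other f v, inord i.+1) else (v, inord i.+1)) =
    (swap f v, inord i.+1) :> V * 'I_N.+1 by rewrite /swap; case: ifP.
  by rewrite sgE; [rewrite (_ : (i < i.+1 <= k)%N) ?swapK //|]; lia.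
have [jk|jk] := eqVneq (j : nat) k.
  rewrite jk lk l'k /= finset.in_set0 leqnn ik /=.
  have -> : (if v \in f then (other f v, inord k.+1) else (v, inord k.+1)) =
    (swap f v, inord k.+1) :> V * 'I_N.+1 by rewrite /swap; case: ifP.
  by rewrite sgE; [rewrite (_ : (i < k.+1 <= k)%N = false) //|]; lia.
rewrite l'E //; case lj: (l j) => [e s].
have [mid|nmid] := boolP (i < j <= k)%N; last first.
  by case: ifP => ve; case: s lj => lj; rewrite ?sgE; try lia;
    rewrite /sg /= ?(negPf nmid) //;
    rewrite (_ : (i < j.+1 <= k)%N = false) //; lia.
have ef : e :&: f = set0 by rewrite -(lmid (j := j)) ?lj //; lia.
rewrite (swap_mem _ ef).
have mid' : (i < j.+1 <= k)%N by lia.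
case: ifP => ve; last by rewrite sgE ?mid' //; lia.
rewrite (swap_fix (swap_disjoint ef ve)).
have of_ := swap_fix (swap_disjoint ef (other_in ve)).
case: s lj => lj; last by rewrite /sg /= mid of_.
by rewrite sgE ?mid' ?of_ //; lia.
Qed.

Let down_l (x : V * 'I_N.+1) : sg (down l x) = down l' (sg x).
Proof.
case: x => v j; have ltj := ltn_ord j.
rewrite /=; case: ifP => [j0|j0].
  have -> : (i < j <= k)%N = false by lia.
  by rewrite sgE // (_ : (i < N <= k)%N = false) //; lia.
have [ji|ji] := eqVneq (j.-1 : nat) i.
  rewrite ji li l'i /= finset.in_set0 (_ : (i < j <= k)%N) //=; last by lia.
  have -> : (if v \in f then (other f v, inord i) else (v, inord i)) =
    (swap f v, inord i) :> V * 'I_N.+1 by rewrite /swap; case: ifP.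
  by rewrite sgE ?ltnn //; lia.
have [jk|jk] := eqVneq (j.-1 : nat) k.
  rewrite jk lk l'k /= finset.in_set0 (_ : (i < j <= k)%N = false) //=; last by lia.
  have -> : (if v \in f then (other f v, inord k) else (v, inord k)) =
    (swap f v, inord k) :> V * 'I_N.+1 by rewrite /swap; case: ifP.
  by rewrite sgE ?ik ?leqnn ?swapK //; lia.
rewrite l'E //; case lj: (l _) => [e s].
have [mid|nmid] := boolP (i < j <= k)%N; last first.
  by case: ifP => ve; case: s lj => lj; rewrite ?sgE; try lia;
    rewrite /sg /= ?(negPf nmid) //;
    rewrite (_ : (i < j.-1 <= k)%N = false) //; lia.
have ef : e :&: f = set0 by rewrite -(lmid (j := j.-1)) ?lj //; lia.
rewrite (swap_mem _ ef).
have mid' : (i < j.-1 <= k)%N by lia.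
case: ifP => ve; last by rewrite sgE ?mid' //; lia.
rewrite (swap_fix (swap_disjoint ef ve)).
have of_ := swap_fix (swap_disjoint ef (other_in ve)).
case: s lj => lj; last by rewrite /sg /= mid of_.
by rewrite sgE ?mid' ?of_ //; lia.
Qed.

Lemma ncomps_pair : ncomps (@adj V N l) = ncomps (@adj V N l').
Proof.
apply: (@ncomps_map _ _ _ _ sg) => [y|x y]; first by exists (sg y).
have conn a b : connect (adj l) a b -> connect (adj l') (sg a) (sg b).
  move: a b; apply: connect_homo; first exact: adj_sym.
    by move=> a; rewrite up_l; apply/connect1/adj_up.
  by move=> a; rewrite down_l; apply/connect1/adj_down.
have conn' a b : connect (adj l') a b -> connect (adj l) (sg a) (sg b).
  move: a b; apply: connect_homo; first exact: adj_sym.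
    by move=> a; rewrite -[X in up l' X]sgK -up_l sgK; apply/connect1/adj_up.
  by move=> a; rewrite -[X in down l' X]sgK -down_l sgK; apply/connect1/adj_down.
by apply/idP/idP => [/conn //|/conn']; rewrite !sgK.
Qed.

End Pair.

Lemma nloops_pair (V : finType) (f : {set V}) (a m z : config V) : #|f| = 2 ->
  all (fun l => l.1 :&: f == set0) m ->
  nloops (a ++ (f, true) :: m ++ (f, true) :: z) = nloops (a ++ m ++ z).
Proof.
move=> f2 mf.
have nthE (x y : link V) j : nth (dummy_link V) (a ++ x :: m ++ y :: z) j =
    if j == size a then x else if j == (size a + size m).+1 then y else
    nth (dummy_link V) (a ++ dummy_link V :: m ++ dummy_link V :: z) j.
  rewrite !nth_cat; case: (ltngtP j (size a)) => [ja|ja|->].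
  - by rewrite (_ : (j == _.+1) = false) //; lia.
  - have [d ->] : exists d, j = (size a + d).+1 by exists (j - (size a).+1); lia.
    rewrite eqSS eqn_add2l -addnS addKn /= !nth_cat.
    case: (ltngtP d (size m)) => // [dm|->]; last by rewrite subnn.
    have [d' ->] : exists d', d = (size m + d').+1 by exists (d - (size m).+1); lia.
    by rewrite -addnS addKn.
  - by rewrite subnn.
(* The crosses are first replaced by null links, which keeps the length and hence the type of gaps;
   the null links are deleted afterwards. *)
transitivity (nloops (a ++ dummy_link V :: m ++ dummy_link V :: z)); last first.
  by rewrite nloops_null catA nloops_null -catA.
rewrite !nloopsE (_ : size (a ++ dummy_link V :: m ++ dummy_link V :: z) =
  size (a ++ (f, true) :: m ++ (f, true) :: z)); last by rewrite !size_cat /= !size_cat.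
apply: (@ncomps_pair V f _ (size a) (size a + size m).+1) => //.
- by lia.
- by rewrite !size_cat /= size_cat /=; lia.
- by rewrite nthE eqxx.
- by rewrite nthE eqxx; case: ifP => // /eqP; lia.
- by rewrite nthE eqxx.
- by rewrite nthE eqxx; case: ifP => // /eqP; lia.
- by move=> j ja jm; rewrite [RHS]nthE (negPf ja) (negPf jm).
- move=> j /andP[aj jm]; rewrite nth_cat ltnNge ltnW //=.
  have [d jd] : exists d, j = (size a + d).+1 by exists (j - (size a).+1); lia.
  have dm : (d < size m)%N by lia.
  rewrite jd -addnS addKn /= nth_cat dm.
  by apply/eqP; apply: (allP mf); exact: mem_nth.
Qed.

(** * Inserting one link changes the number of loops by at most one *)

Section Directed.
Variables (V : finType) (N : nat).
Local Notation gap := (V * 'I_N.+1)%type.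
Implicit Types (l : nat -> link V) (p : gap * bool).

Definition rev p : gap * bool := (p.1, ~~ p.2).

Lemma revE (x : gap) d : rev (x, d) = (x, ~~ d). Proof. by []. Qed.

Lemma revK : involutive rev.
Proof. by case=> x d; rewrite /rev /= negbK. Qed.

Definition turn l p : bool :=
  if p.2 then [&& (p.1.2 : nat) != N, p.1.1 \in (l p.1.2).1 & ~~ (l p.1.2).2]
  else [&& (p.1.2 : nat) != 0%N, p.1.1 \in (l p.1.2.-1).1 & ~~ (l p.1.2.-1).2].

(** Because double bars reverse time, the steps on gaps need not form a permutation. They do on gaps
    with a direction, where [true] means upwards. *)
Definition dstep l p : gap * bool :=
  (if p.2 then up l p.1 else down l p.1, p.2 (+) turn l p).

Definition proper_links l := forall j, (j < N)%N -> #|(l j).1| = 2 \/ (l j).1 = set0.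

Lemma dstep_up l v (j : 'I_N.+1) : (j < N)%N -> dstep l (v, j, true) =
  if v \in (l j).1 then
    if (l j).2 then (other (l j).1 v, inord j.+1, true) else (other (l j).1 v, j, false)
  else (v, inord j.+1, true).
Proof.
move=> jN; rewrite /dstep /turn /= (ltn_eqF jN); case: (l j) => e s /=.
by case: (v \in e); case: s.
Qed.

Lemma dstep_top l v (j : 'I_N.+1) : j = N :> nat ->
  dstep l (v, j, true) = (v, inord 0, true).
Proof. by move=> jN; rewrite /dstep /turn /= jN eqxx. Qed.

Lemma dstep_down l v (j : 'I_N.+1) : (0 < j)%N -> dstep l (v, j, false) =
  if v \in (l j.-1).1 then
    if (l j.-1).2 then (other (l j.-1).1 v, inord j.-1, false)
    else (other (l j.-1).1 v, j, true)
  else (v, inord j.-1, false).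
Proof.
move=> j0; rewrite /dstep /turn /= (gtn_eqF j0); case: (l j.-1) => e s /=.
by case: (v \in e); case: s.
Qed.

Lemma dstep_bot l v (j : 'I_N.+1) : j = 0 :> nat ->
  dstep l (v, j, false) = (v, inord N, false).
Proof. by move=> j0; rewrite /dstep /turn /= j0 eqxx. Qed.

Section Proper.
Variable l : nat -> link V.
Hypothesis lP : proper_links l.

(** Loops can be retraced: time reversal turns a step into its inverse. Injectivity of the step
    follows. *)
Lemma rev_dstep p : rev (dstep l (rev (dstep l p))) = p.
Proof.
have ol j v : (j < N)%N -> v \in (l j).1 ->
    [/\ other (l j).1 v \in (l j).1 & other (l j).1 (other (l j).1 v) = v].
  move=> jN vl; have [l2|l0] := lP jN; last by rewrite l0 inE in vl.
  by split; [exact: other_in | exact: otherK].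
case: p => [[v j] d]; have ltj := ltn_ord j; case: d.
  have [jN|jN] := eqVneq (j : nat) N.
    rewrite dstep_top // revE dstep_bot ?inordK // revE; congr (_, _, _).
    by apply: val_inj; rewrite /= inordK.
  have jlt : (j < N)%N by lia.
  have ij : (inord j.+1 : 'I_N.+1) = j.+1 :> nat by rewrite inordK.
  have io : inord j = j by apply: val_inj; rewrite /= inordK.
  have oe := ol j v jlt.
  rewrite dstep_up //; case: ifP => [/oe[o1 o2]|ve].
    case: ifP => lj; rewrite revE; last by rewrite dstep_up // o1 lj o2.
    by rewrite dstep_down ?ij // o1 lj o2 io.
  by rewrite revE dstep_down ?ij // ve io.
have [j0|j0] := eqVneq (j : nat) 0.
  rewrite dstep_bot // revE dstep_top ?inordK // revE; congr (_, _, _).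
  by apply: val_inj; rewrite /= inordK.
have jlt : (j.-1 < N)%N by lia.
have jgt : (0 < j)%N by lia.
have ij : (inord j.-1 : 'I_N.+1) = j.-1 :> nat by rewrite inordK; lia.
have io : inord j.-1.+1 = j by apply: val_inj; rewrite /= prednK ?inordK.
have oe := ol j.-1 v jlt.
rewrite dstep_down //; case: ifP => [/oe[o1 o2]|ve].
  case: ifP => lj; rewrite revE; last by rewrite dstep_down // o1 lj o2.
  by rewrite dstep_up ?ij // o1 lj o2 io.
by rewrite revE dstep_up ?ij // ve io.
Qed.

Lemma dstep_inj : injective (dstep l).
Proof.
move=> p q pq; apply: (inv_inj revK); rewrite -[rev p]rev_dstep -[rev q]rev_dstep.
by rewrite -[in LHS](rev_dstep p) -[in RHS](rev_dstep q) pq.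
Qed.

Definition dperm := perm dstep_inj.

Lemma dpermE p : dperm p = dstep l p.
Proof. by rewrite permE. Qed.

Lemma dperm_rev p : dperm (rev (dperm p)) = rev p.
Proof. by apply: (inv_inj revK); rewrite !dpermE rev_dstep revK. Qed.

(* A loop never returns to a point in the opposite direction, so it is the
   projection of exactly two directed cycles. *)
Lemma dperm_neq_rev n p : (dperm ^+ n)%g p <> rev p.
Proof.
have [m] := ubnP n; elim: m n p => // m IH [|[|n]] p.
- by rewrite expg0 perm1; case: p => x [].
- rewrite expg1 dpermE; case: p => [[v j] d] _; have ltj := ltn_ord j.
  have no k : (k < N)%N -> v \in (l k).1 -> other (l k).1 v <> v.
    move=> kN vk; have [l2|l0] := lP kN; last by rewrite l0 inE in vk.
    exact/eqP/other_neq.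
  case: d; rewrite /rev /=.
    have [jN|jN] := eqVneq (j : nat) N; first by rewrite dstep_top.
    have jlt : (j < N)%N by lia.
    rewrite dstep_up //; case: ifP => // /(no _ jlt) ne.
    by case: ifP => // _ [/ne].
  have [j0|j0] := eqVneq (j : nat) 0; first by rewrite dstep_bot.
  have jlt : (j.-1 < N)%N by lia.
  rewrite dstep_down; last by lia.
  by case: ifP => // /(no _ jlt) ne; case: ifP => // _ [/ne].
(* Two steps are cancelled at once: if n+2 steps lead from [p] to [rev p], then n steps lead from
   [dperm p] to its own reversal. *)
- rewrite ltnS => nm eqr; apply: (IH n (dperm p)); first by lia.
  apply: (@perm_inj _ dperm); rewrite dperm_rev -eqr.
  by rewrite -permM -expgSr -permM -expgS.
Qed.

Lemma adj_dperm y z : adj l y z -> exists d d', dperm (y, d) = (z, d').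
Proof.
have rv a d b d' : dperm (a, d) = (b, d') -> dperm (b, ~~ d') = (a, ~~ d).
  by move=> E; have := dperm_rev (a, d); rewrite E.
case/or4P => /eqP <-.
- by exists true; rewrite dpermE /dstep /=; eexists.
- by exists false; rewrite dpermE /dstep /=; eexists.
- have : dperm (z, true) = (up l z, true (+) turn l (z, true)) by rewrite dpermE.
  by move/rv => E; do 2!eexists; exact: E.
- have : dperm (z, false) = (down l z, false (+) turn l (z, false)) by rewrite dpermE.
  by move/rv => E; do 2!eexists; exact: E.
Qed.

Lemma connect_dperm x d y :
  connect (adj l) x y = [exists d', (y, d') \in porbit dperm (x, d)].
Proof.
have step p : dperm p \in porbit dperm p by have := mem_porbit dperm 1 p; rewrite expg1.
apply/idP/existsP => [/connectP[q]|[d' /porbitP[n]]].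
  elim/last_ind: q y => [|q z IH] y /=; first by move=> _ ->; exists d; exact: porbit_id.
  rewrite rcons_path last_rcons => /andP[xq qz] ->.
  have [d' hd'] := IH _ xq erefl.
  have [d1 [d2 E]] := adj_dperm qz.
  have [dd|dd] := eqVneq d1 d'.
    exists d2; rewrite -E dd; rewrite -eq_porbit_mem in hd'.
    by rewrite -(eqP hd').
  (* Here the adjacency runs against the current direction; reversed, it is a step of the
     permutation into the current state. *)
  exists (~~ d2); have E' : dperm (z, ~~ d2) = (last x q, d').
    have := dperm_rev (last x q, d1); rewrite E /rev /= => ->.
    by congr (_, _); move: dd; case: (d1); case: (d').
  rewrite -eq_porbit_mem in hd'; by rewrite -(eqP hd') -E' porbit_sym.
elim: n y d' => [|n IH] y d'.
  by rewrite expg0 perm1 => -[-> _]; exact: connect0.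
rewrite expgSr permM; case En: ((dperm ^+ n)%g (x, d)) => [w dw].
rewrite dpermE => -[yw _]; apply: connect_trans (IH _ _ (esym En)) _.
by rewrite yw; apply: connect1; case: (dw); [exact: adj_up | exact: adj_down].
Qed.

Lemma card_porbits_dperm : #|porbits dperm| = (ncomps (@adj V N l)).*2.
Proof.
pose F (O : {set gap * bool}) := [set x | [exists d, (x, d) \in O]].
pose C (x : gap) := [set y | connect (adj l) x y].
have FC x d : F (porbit dperm (x, d)) = C x.
  by apply/setP => y; rewrite !inE (connect_dperm x d).
have CE x y : (C x == C y) = connect (adj l) x y.
  apply/eqP/idP => [/setP/(_ y)|xy]; first by rewrite !inE connect0.
  by apply/setP => z; rewrite !inE (same_connect (@adj_sym V N l) xy).
have orb x d : porbit dperm (x, d) \in porbits dperm by apply: imset_f.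
rewrite /ncomps -/C -sum1_card.
rewrite (partition_big F [in [set C x | x : gap]]) /=; last first.
  by move=> O /imsetP[[x d] _ ->]; rewrite FC imset_f.
rewrite -muln2 -sum_nat_const; apply: eq_bigr => _ /imsetP[x _ ->].
rewrite sum1_card.
have -> : #|[pred O in porbits dperm | F O == C x]| =
          #|[set porbit dperm (x, true); porbit dperm (x, false)]|.
  apply: eq_card => O; rewrite !inE; apply/andP/orP.
    case=> /imsetP[[y d] _ ->]; rewrite FC CE (connect_dperm y d).
    case/existsP => -[] h; [left|right]; rewrite eq_porbit_mem //.
      by rewrite porbit_sym.
    by rewrite porbit_sym.
  by case=> /eqP ->; rewrite FC orb eqxx.
rewrite cards2 eq_porbit_mem porbit_sym.
case: (boolP (_ \in _)) => // /porbitP[n En].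
by case: (@dperm_neq_rev n (x, true)); rewrite /rev /= -En.
Qed.

End Proper.
End Directed.

Section Insert.
Variables (V : finType) (N i : nat) (f : {set V}) (s : bool) (l l' : nat -> link V).
Hypotheses (lP : proper_links N l) (l'P : proper_links N l').
Hypotheses (iN : (i < N)%N) (f2 : #|f| = 2).
Hypotheses (li : l i = (f, s)) (l'i : l' i = dummy_link V).
Hypothesis l'E : forall j, j != i -> l' j = l j.
Local Notation gap := (V * 'I_N.+1)%type.

Let i0 : 'I_N.+1 := inord i.
Let i1 : 'I_N.+1 := inord i.+1.
Let i0E : i0 = i :> nat. Proof. by rewrite /i0 inordK //; lia. Qed.
Let i1E : i1 = i.+1 :> nat. Proof. by rewrite /i1 inordK. Qed.

(* The two crossings of the link, one in each time direction, are rerouted. *)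
Let tau (p : gap * bool) : gap * bool :=
  let: (v, j, d) := p in
  if v \in f then
    if d && (j == i0) then (other f v, if s then i0 else i1, s)
    else if ~~ d && (j == i1) then (other f v, if s then i1 else i0, ~~ s)
    else p
  else p.

Let dperm_tau p : dperm lP p = dperm l'P (tau p).
Proof.
rewrite !dpermE; case: p => [[v j] d].
have nf : (v \notin f) || ((j != i0) || ~~ d) && ((j != i1) || d) ->
    dstep l (v, j, d) = dstep l' (v, j, d).
  move=> h; rewrite /dstep /turn /=; case: d h => /= h.
    have [ji|ji] := eqVneq (j : nat) i; last by rewrite l'E.
    have vf : v \notin f.
      move: h; have -> : j == i0 by rewrite -val_eqE /= i0E ji.
      by case: (v \notin f); case: (j == i1).
    by rewrite ji li l'i /= inE (negPf vf).
  have [ji|ji] := eqVneq (j.-1 : nat) i; last by rewrite l'E.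
  case: eqP => //= j0.
  have vf : v \notin f.
    move: h; have -> : j == i1 by rewrite -val_eqE /= i1E -ji prednK //; lia.
    by case: (v \notin f); case: (j == i0).
  by rewrite ji li l'i /= inE (negPf vf).
rewrite /tau; case: ifP => vf; last by rewrite nf ?vf.
have i0N : (i0 < N)%N by rewrite i0E.
have i1p : (0 < i1)%N by rewrite i1E.
case: ifP => [/andP[dd /eqP ->]|h1].
  rewrite dd dstep_up // i0E li /= vf; case: (s).
    by rewrite dstep_up // i0E l'i /= finset.in_set0.
  rewrite dstep_down // i1E /= l'i /= finset.in_set0 /=.
  by congr (_, _, _); apply: val_inj; rewrite /= i0E inordK //; lia.
case: ifP => [/andP[dd /eqP ->]|h2].
  rewrite (negPf dd) dstep_down // i1E /= li /= vf; case: (s).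
    by rewrite dstep_down // i1E /= l'i /= finset.in_set0.
  by rewrite dstep_up // i0E l'i /= finset.in_set0.
rewrite nf // vf; move: h1 h2.
by case: (d); case: (j == i0); case: (j == i1).
Qed.

Lemma porbits_insert : (#|porbits (dperm lP)| <= #|porbits (dperm l'P)| + 2)%N /\
  (#|porbits (dperm l'P)| <= #|porbits (dperm lP)| + 2)%N.
Proof.
have /set0Pn[v vf] : f != set0 by rewrite -card_gt0 f2.
have fE w : (w \in f) = (w == v) || (w == other f v).
  suff /eqP/setP/(_ w) <- : [set v; other f v] == f by rewrite !inE.
  rewrite eqEcard subUset !sub1set vf other_in //= cards2 f2.
  by rewrite eq_sym other_neq.
have i01 : (i0 == i1) = false by rewrite -val_eqE /= i0E i1E; lia.
have ov := negPf (other_neq f2 vf).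
pose a1 : gap * bool := (v, i0, true).
pose a2 : gap * bool := (other f v, if s then i0 else i1, s).
pose b1 : gap * bool := (v, i1, false).
pose b2 : gap * bool := (other f v, if s then i1 else i0, ~~ s).
have -> : dperm lP = (tperm a1 a2 * (tperm b1 b2 * dperm l'P))%g.
  apply/permP => p; rewrite !permM dperm_tau; congr (dperm l'P _).
  have E0 : tau a1 = a2 by rewrite /tau /a1 vf eqxx.
  have E1 : tau b1 = b2 by rewrite /tau /b1 vf eqxx.
  have E2 : tau a2 = a1.
    rewrite /tau /a2 other_in // otherK // ; case: (s) => /=; rewrite ?eqxx //.
  have E3 : tau b2 = b1.
    rewrite /tau /b2 other_in // otherK // ; case: (s) => /=; rewrite ?eqxx //.
  have ne (x y : gap * bool) : (x == y) = false -> x <> y by move/eqP.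
  case: (tpermP a1 a2 p) => [->|->|pa1 pa2].
  - rewrite E0 tpermD //; apply/eqP/ne; rewrite /a2 /b1 /b2 !xpair_eqE /= ?[_ == other _ _]eq_sym ?ov //.
    by rewrite eqxx; case: (s); rewrite /= ?andbF.
  - rewrite E2 tpermD //; apply/eqP/ne; rewrite /a1 /b1 /b2 !xpair_eqE /= ?ov ?andbF //.
  - case: (tpermP b1 b2 p) => [->|->|pb1 pb2] //.
    move: pa1 pa2 pb1 pb2; case: p => [[w j] d]; rewrite /tau.
    case: ifP => //; rewrite fE => /orP[] /eqP -> /eqP pa1 /eqP pa2 /eqP pb1 /eqP pb2.
      case: ifP => [/andP[dd /eqP jj]|_].
        by move: pa1; rewrite jj dd eqxx.
      case: ifP => [/andP[dd /eqP jj]|//].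
      by move: pb1; rewrite jj (negPf dd) eqxx.
    move: pa2 pb2; rewrite /a2 /b2.
    by case: (s); case: (d) => //= pa2 pb2; case: ifP => // /eqP jj;
      move: pa2 pb2; rewrite jj eqxx.
have count (A B C : nat) (c c' : bool) : (B + c.*2 = C + 1 ->
    A + c'.*2 = B + 1 -> A <= C + 2 /\ C <= A + 2)%N.
  by case: c; case: c'; lia.
have := porbits_mul_tperm (dperm l'P) b1 b2.
have := porbits_mul_tperm (tperm b1 b2 * dperm l'P) a1 a2.
have -> : (a1 != a2) = true by rewrite !xpair_eqE eq_sym ov.
have -> : (b1 != b2) = true by rewrite !xpair_eqE eq_sym ov.
by move=> h1 h2; exact: count h2 h1.
Qed.

(** Every loop accounts for two directed cycles, so a change by at most two cycles is a change by at
    most one loop. *)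
Lemma ncomps_insert : (ncomps (@adj V N l) <= ncomps (@adj V N l') + 1)%N /\
  (ncomps (@adj V N l') <= ncomps (@adj V N l) + 1)%N.
Proof. by have := porbits_insert; rewrite !card_porbits_dperm; lia. Qed.

End Insert.

Lemma nloops_insert (V : finType) (f : {set V}) (s : bool) (a z : config V) :
  #|f| = 2 -> all (fun l : link V => #|l.1| == 2) (a ++ z) ->
  (nloops (a ++ (f, s) :: z) <= nloops (a ++ z) + 1)%N /\
  (nloops (a ++ z) <= nloops (a ++ (f, s) :: z) + 1)%N.
Proof.
move=> f2 az; rewrite -(nloops_null a z) !nloopsE.
have eqs : size (a ++ dummy_link V :: z) = size (a ++ (f, s) :: z) by rewrite !size_cat.
rewrite eqs.
have nthE (x : link V) j : nth (dummy_link V) (a ++ x :: z) j =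
    if j == size a then x else nth (dummy_link V) (a ++ dummy_link V :: z) j.
  rewrite !nth_cat; case: ltngtP => // [ja|->]; last by rewrite subnn.
  have [d ->] : exists d, j = (size a + d).+1 by exists (j - (size a).+1); lia.
  by rewrite -addnS addKn.
have prop (x : link V) : #|x.1| = 2 \/ x.1 = set0 ->
    proper_links (size (a ++ (f, s) :: z)) (nth (dummy_link V) (a ++ x :: z)).
  move=> xP j; rewrite -eqs => js; have : nth (dummy_link V) (a ++ x :: z) j \in a ++ x :: z.
    by apply: mem_nth; move: js; rewrite !size_cat.
  rewrite mem_cat inE orbCA -mem_cat => /orP[/eqP -> //|h].
  by left; apply/eqP; exact: (allP az).
apply: (@ncomps_insert V _ (size a) f s).
- by apply: prop; left.
- by apply: prop; right.
- by rewrite size_cat /=; lia.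
- by [].
- by rewrite nthE eqxx.
- by rewrite nthE eqxx.
- by move=> j ja; rewrite [RHS]nthE (negPf ja).
Qed.

(** * Blocking edges *)

Arguments Nlinks : simpl never.

Section Blocking.
Variable V : finType.
Implicit Types (a c m z : config V) (l : link V) (e f g : {set V}).

Definition touch l g : bool := l.1 :&: g != set0.

Lemma touch_edge l g : #|g| = 2 -> l.1 = g -> touch l g.
Proof. by move=> g2 lg; rewrite /touch lg setIid -card_gt0 g2. Qed.

Lemma Nlinks_cat a z g : Nlinks (a ++ z) g = (Nlinks a g + Nlinks z g)%N.
Proof. exact: count_cat. Qed.

Lemma Nlinks_cons l z g : Nlinks (l :: z) g = ((l.1 == g) + Nlinks z g)%N.
Proof. by []. Qed.

Lemma Nlinks_first a g : (0 < Nlinks a g)%N ->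
  exists a1 l a2, [/\ a = a1 ++ l :: a2, l.1 = g & Nlinks a1 g = 0%N].
Proof.
elim: a => [|l a IH] //; rewrite Nlinks_cons.
have [lg _|lg] := eqVneq l.1 g; first by exists [::], l, a.
by case/IH => a1 [l' [a2 [-> lg' a10]]]; exists (l :: a1), l', a2;
  rewrite Nlinks_cons (negPf lg).
Qed.

Lemma Nlinks_untouched m g : #|g| = 2 ->
  all (fun l : link V => ~~ touch l g) m -> Nlinks m g = 0%N.
Proof.
move=> g2 mg; apply/eqP; rewrite -leqn0 leqNgt; apply/negP => /Nlinks_first.
case=> [a1 [l [a2 [me lg _]]]]; move: mg.
by rewrite me all_cat /= (touch_edge g2 lg) andbF.
Qed.

(* [n] counts the links on [g] met so far: between the two links on a blocking
   edge it equals 1. *)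
Fixpoint unbarred g n c : bool :=
  if c is l :: c' then
    if l.1 == g then unbarred g n.+1 c'
    else ~~ ((n == 1%N) && touch l g) && unbarred g n c'
  else true.

Lemma unbarred_cat g n a z :
  unbarred g n (a ++ z) = unbarred g n a && unbarred g (n + Nlinks a g) z.
Proof.
elim: a n => [|l a IH] n /=; first by rewrite addn0.
rewrite Nlinks_cons; case: ifP => _; rewrite IH; first by rewrite addnCA addnA.
by rewrite add0n andbA.
Qed.

Lemma unbarredP g n c : reflect
  (forall a l z, c = a ++ l :: z -> l.1 != g -> (n + Nlinks a g = 1)%N -> ~~ touch l g)
  (unbarred g n c).
Proof.
apply: (iffP idP) => [cg a l z ce lg na|h].
  move: cg; rewrite ce unbarred_cat /= (negPf lg) => /and3P[_ + _].
  by rewrite na eqxx.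
elim: c n h => [|l c IH] n h //=; case: ifP => lg.
  apply: IH => a l' z ce lg' na; apply: (h (l :: a) l' z) => //=; first by rewrite ce.
  by rewrite Nlinks_cons lg addnCA addnA.
apply/andP; split.
  by rewrite negb_and -implybE; apply/implyP => /eqP n1; apply: (h [::] l c); rewrite ?lg ?addn0.
apply: IH => a l' z ce lg' na; apply: (h (l :: a) l' z) => //=; first by rewrite ce.
by rewrite Nlinks_cons lg.
Qed.

(** Replaces the condition on triples of indices by a scan from the left, which splits along
    concatenations. *)
Lemma blockingE c g : blocking c g =
  [&& Nlinks c g == 2%N, all (fun l : link V => (l.1 == g) ==> l.2) c & unbarred g 0 c].
Proof.
rewrite /blocking; case: eqP => //= c2; congr (_ && _).
apply/idP/unbarredP => [h a l z ce lg|h].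
  rewrite add0n => a1; have /Nlinks_first[a' [l1 [a'' [ae l1g _]]]] : (0 < Nlinks a g)%N by rewrite a1.
  have /Nlinks_first[z' [l2 [z'' [ze l2g _]]]] : (0 < Nlinks z g)%N.
    by move: c2; rewrite ce Nlinks_cat Nlinks_cons (negPf lg) a1 /=; lia.
  have sc : size c = (size a' + size a'' + size z' + size z'' + 3)%N.
    by rewrite ce ae ze !size_cat /= !size_cat /=; lia.
  have i1 : (size a' < size c)%N by lia.
  have i2 : (size a < size c)%N by rewrite sc ae size_cat /=; lia.
  have i3 : (size a + (size z').+1 < size c)%N by rewrite sc ae size_cat /=; lia.
  move/forallP/(_ (Ordinal i1))/forallP/(_ (Ordinal i3))/forallP/(_ (Ordinal i2))/implyP: h.
  have n1 : nth (dummy_link V) c (size a') = l1.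
    by rewrite ce ae -catA nth_cat ltnn subnn.
  have n2 : nth (dummy_link V) c (size a) = l by rewrite ce nth_cat ltnn subnn.
  have n3 : nth (dummy_link V) c (size a + (size z').+1) = l2.
    by rewrite ce nth_cat ltnNge leq_addr /= addKn /= ze nth_cat ltnn subnn.
  rewrite /= n1 n2 n3 l1g l2g eqxx /= => h; rewrite negbK; apply: h.
  by rewrite ae size_cat /=; lia.
apply/forallP => i; apply/forallP => j; apply/forallP => k; apply/implyP.
case/and4P => /eqP ig /eqP jg ik kj.
have := cat_take_drop k c; rewrite (drop_nth (dummy_link V)) // => ce.
set a := take k c in ce; set z := drop k.+1 c in ce; set l := nth _ c k in ce *.
have ca : (0 < Nlinks a g)%N.
  rewrite -has_count; apply/hasP; exists (nth (dummy_link V) c i); last exact/eqP.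
  by rewrite -(nth_take (n0 := k)) //; apply: mem_nth; rewrite size_take ltn_ord.
have cz : (0 < Nlinks z g)%N.
  rewrite -has_count; apply/hasP; exists (nth (dummy_link V) c j); last exact/eqP.
  have -> : nth (dummy_link V) c j = nth (dummy_link V) z (j - k.+1).
    by rewrite nth_drop subnKC.
  by apply: mem_nth; rewrite size_drop ltn_sub2r // (leq_ltn_trans kj).
move: c2; rewrite -{1}ce Nlinks_cat Nlinks_cons => c2.
rewrite -[_ == _]negbK; apply: (h a l z); first by rewrite ce.
  by move: c2; case: eqP => //; lia.
by move: c2; case: eqP; lia.
Qed.

(** A link off [g] leaves the number and types of the links on [g] alone. It can do harm only
    between the two of them, that is, where exactly one has been met. *)
Lemma blocking_insert a l z g : l.1 != g ->
  blocking (a ++ l :: z) g = blocking (a ++ z) g && ~~ ((Nlinks a g == 1%N) && touch l g).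
Proof.
move=> lg; rewrite !blockingE !Nlinks_cat Nlinks_cons (negPf lg) !all_cat /=.
rewrite (negPf lg) !unbarred_cat /= (negPf lg) add0n -!andbA; congr (_ && _).
do 3!congr (_ && _); exact: andbC.
Qed.

Lemma blocking_Nlinks c g : blocking c g -> Nlinks c g = 2%N.
Proof. by case/and3P => /eqP. Qed.

Lemma blocking_sub a z z' g : subseq z' z -> Nlinks z' g = Nlinks z g ->
  blocking (a ++ z) g -> blocking (a ++ z') g.
Proof.
elim: z z' a => [|l z IH] [|l' z'] a //=; last first.
  case: eqP => [-> zz|_ zz] en.
    rewrite -!cat_rcons; apply: IH => //.
    by move: en; rewrite !Nlinks_cons => /addnI.
  have lg : l.1 != g.
    apply/negP => lg; have := leq_count_subseq (fun l => l.1 == g) zz.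
    move: en; rewrite [RHS]Nlinks_cons lg /Nlinks => ->.
    by rewrite ltnn.
  rewrite blocking_insert // => /andP[b _]; apply: IH zz _ b.
  by rewrite en Nlinks_cons (negPf lg).
move=> _; rewrite Nlinks_cons; case: (boolP (l.1 == g)) => //= lg en.
rewrite blocking_insert // => /andP[b _]; apply: IH _ _ b => //.
exact: sub0seq.
Qed.

Definition erase e c : config V := [seq l <- c | l.1 != e].

Lemma Nlinks_erase e c g : g != e -> Nlinks (erase e c) g = Nlinks c g.
Proof.
move=> ge; rewrite /Nlinks count_filter; apply: eq_count => l /=.
by case: eqP => //= ->; rewrite ge.
Qed.

Lemma blocking_erase e c g : g != e -> blocking c g -> blocking (erase e c) g.
Proof.
move=> ge; apply: (@blocking_sub [::]); first exact: filter_subseq.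
exact: Nlinks_erase.
Qed.

Lemma blocking_erase_disjoint e c g : g != e -> e :&: g = set0 ->
  blocking (erase e c) g = blocking c g.
Proof.
move=> ge eg; rewrite -[erase e c]cat0s -[in RHS](cat0s c).
elim: c [::] => [|l c IH] a //=; case: (eqVneq l.1 e) => le /=.
  rewrite IH blocking_insert ?le 1?eq_sym //.
  by rewrite (_ : touch l g = false) ?andbF ?andbT // /touch le eg eqxx.
by rewrite -!cat_rcons IH.
Qed.

(** If the deleted cross alone kept [g] from blocking, it would lie between the crosses of [g] and
    touch [g]. The other cross on [f] touches [g] as well, so it lies outside them. Then a cross on
    [g] separates the two crosses on [f], and [f] would not be blocking. *)
Lemma blocking_remove_edge a l z f g : #|f| = 2 -> l.1 = f -> g != f ->
  blocking (a ++ l :: z) f -> blocking (a ++ z) g = blocking (a ++ l :: z) g.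
Proof.
move=> f2 lf gf bf; have lg : l.1 != g by rewrite lf eq_sym.
rewrite blocking_insert //; case bg: (blocking (a ++ z) g) => //=; symmetry.
apply/negP => /andP[/eqP ag tg].
have := blocking_Nlinks bf; rewrite Nlinks_cat Nlinks_cons lf eqxx => nf.
move: bf; rewrite blockingE => /and3P[_ _ /unbarredP uf].
move: bg; rewrite blockingE => /and3P[_ _ /unbarredP ug].
have tfg (k h : link V) : k.1 = g -> h.1 = f -> touch k f /\ touch h g.
  by move=> kg hf; move: tg; rewrite /touch lf kg hf setIC.
have [fa|fz] : (0 < Nlinks a f)%N \/ (0 < Nlinks z f)%N by lia.
  case/Nlinks_first: (fa) => a1 [h [a2 [ae hf a10]]].
  have gh : h.1 != g by rewrite hf eq_sym.
  have gn1 : Nlinks a1 g <> 1%N.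
    move=> g1; have := ug a1 h (a2 ++ z); rewrite ae -catA add0n => /(_ erefl gh g1).
    by have [_ ->] := tfg (g, true) h erefl hf.
  move: ag; rewrite ae Nlinks_cat Nlinks_cons (negPf gh) => ag.
  have /Nlinks_first[a3 [k [a4 [a2e kg _]]]] : (0 < Nlinks a2 g)%N by lia.
  have := uf (a1 ++ h :: a3) k (a4 ++ l :: z).
  rewrite ae a2e -!catA /= -?catA add0n => /(_ erefl); rewrite kg => /(_ gf).
  have [-> _] := tfg k h kg hf; move=> /(_ _)/negP/(_ isT) H; apply: H.
  move: nf; rewrite ae a2e !(Nlinks_cat, Nlinks_cons) hf eqxx a10; lia.
case/Nlinks_first: (fz) => z1 [h [z2 [ze hf z10]]].
have gh : h.1 != g by rewrite hf eq_sym.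
have gn1 : (Nlinks a g + Nlinks z1 g)%N <> 1%N.
  move=> g1; have := ug (a ++ z1) h z2; rewrite ze -catA add0n => /(_ erefl gh).
  by rewrite Nlinks_cat => /(_ g1); have [_ ->] := tfg (g, true) h erefl hf.
have /Nlinks_first[z3 [k [z4 [z1e kg _]]]] : (0 < Nlinks z1 g)%N by lia.
have := uf (a ++ l :: z3) k (z4 ++ h :: z2).
rewrite ze z1e -!catA /= -?catA add0n => /(_ erefl); rewrite kg => /(_ gf).
have [-> _] := tfg k h kg hf; move=> /(_ _)/negP/(_ isT) H; apply: H.
move: nf z10; rewrite ze z1e !(Nlinks_cat, Nlinks_cons) hf lf !eqxx; lia.
Qed.

(** The second premise on blocking shows that [l] does no harm to [g], the first that nothing else
    does. Hence, among the links on one edge, at most one can be the sole obstacle to [g] being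
    blocking. *)
Lemma blocking_critical a l m l' z g : l.1 != g -> l'.1 = l.1 ->
  blocking (a ++ m ++ l' :: z) g -> blocking (a ++ l :: m ++ z) g ->
  blocking (a ++ l :: m ++ l' :: z) g.
Proof.
by move=> lg ll b; rewrite !blocking_insert // => /andP[_ ->]; rewrite b.
Qed.

(** The links in [m] lie between the two crosses of [g] and avoid [g]. An edge meeting [g] thus has
    no link in [m], so it does not notice [l] moving across [m]; an edge disjoint from [g] ignores
    [l] anyway. *)
Lemma blocking_move a l m z g : #|g| = 2 -> l.1 = g -> Nlinks a g = 1%N ->
  Nlinks m g = 0%N -> blocking (a ++ m ++ l :: z) g ->
  all (fun l : link V => ~~ touch l g) m /\
  (forall h, blocking (a ++ l :: m ++ z) h = blocking (a ++ m ++ l :: z) h).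
Proof.
move=> g2 lg a1 m0 bg.
have mt : all (fun l : link V => ~~ touch l g) m.
  apply/allP => k /path.splitPr km; case: km bg m0 => m1 m2.
  rewrite blockingE => /and3P[_ _ /unbarredP ug].
  rewrite Nlinks_cat Nlinks_cons => m0.
  apply: (ug (a ++ m1) k (m2 ++ l :: z)); first by rewrite -!catA.
    by case: eqP m0 => //; lia.
  by rewrite Nlinks_cat; lia.
split=> // h; have [<-|hg] := eqVneq l.1 h.
  rewrite lg bg; move: bg; rewrite !blockingE => /and3P[n2 ac].
  rewrite !(all_cat, unbarred_cat) /= !(all_cat, unbarred_cat) /= lg eqxx !add0n a1 m0 addn0.
  move: n2 ac; rewrite !(Nlinks_cat, Nlinks_cons) lg eqxx !all_cat /= lg eqxx => n2 ac.
  move=> /and3P[ua _ ->]; rewrite ua andbT.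
  apply/and3P; split; first by lia.
    by case/and4P: ac => -> -> /= -> ->.
  apply/unbarredP => a' k z' me _ _; move: mt; rewrite me all_cat /=.
  by case/and3P.
rewrite blocking_insert // !catA blocking_insert // Nlinks_cat.
case: (boolP (touch l h)) => [lh|]; last by rewrite !andbF.
rewrite (_ : Nlinks m h = 0%N) ?addn0 //.
apply/eqP; rewrite -leqn0 leqNgt; apply/negP => /Nlinks_first[m1 [k [m2 [me kh _]]]].
move: mt; rewrite me all_cat /= => /and3P[_ + _].
by rewrite /touch kh setIC -lg -/(touch l h) lh.
Qed.

End Blocking.

From mathcomp Require Import all_classical all_reals all_analysis.
From mathcomp Require Import ring lra.
Import Order.TTheory GRing.Theory Num.Theory.
Import numFieldNormedType.Exports.
Local Open Scope ring_scope.

(** * Weights and removal of a link *)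

Lemma ler_sum_inj (R : numDomainType) (S T : eqType) (s : seq S) (t : seq T)
    (P : pred S) (Q : pred T) (a : S -> R) (b : T -> R) (h : S -> T) :
  uniq s -> uniq t ->
  (forall x, x \in s -> P x -> [/\ h x \in t, Q (h x) & a x <= b (h x)]) ->
  (forall x x', x \in s -> P x -> x' \in s -> P x' -> h x = h x' -> x = x') ->
  (forall y, Q y -> 0 <= b y) ->
  \sum_(x <- s | P x) a x <= \sum_(y <- t | Q y) b y.
Proof.
move=> us ut hP hinj b0; pose s' := [seq x <- s | P x].
have s'P x : x \in s' -> x \in s /\ P x by rewrite mem_filter => /andP[].
have uh : uniq [seq h x | x <- s'].
  rewrite map_inj_in_uniq ?filter_uniq // => x x' /s'P[xs Px] /s'P[xs' Px'].
  exact: hinj.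
rewrite -big_filter -/s'.
apply: (@le_trans _ _ (\sum_(x <- s') b (h x))).
  by rewrite !big_seq; apply: ler_sum => x /s'P[xs Px]; have [] := hP x xs Px.
rewrite -(big_map h xpredT b) -[leRHS]big_filter; set t' := [seq y <- t | Q y].
have sub : {subset [seq h x | x <- s'] <= t'}.
  move=> _ /mapP[x /s'P[xs Px] ->]; have [ht hQ _] := hP x xs Px.
  by rewrite mem_filter hQ.
have -> : \sum_(z <- [seq h x | x <- s']) b z =
    \sum_(z <- t' | z \in [seq h x | x <- s']) b z.
  rewrite -[RHS]big_filter; apply: perm_big; apply: uniq_perm => //.
    by rewrite !filter_uniq.
  by move=> z; rewrite [RHS]mem_filter; symmetry; apply: andb_idr; exact: sub.
rewrite [leRHS](bigID (mem [seq h x | x <- s'])) /= lerDl.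
rewrite big_seq_cond; apply: sumr_ge0 => z /andP[+ _].
by rewrite mem_filter => /andP[/b0].
Qed.

Section Weights.
Variable V : finType.
Implicit Types (a c m z : config V) (e f g : {set V}) (n : nat).

Definition configs_lt n : seq (config V) :=
  flatten [seq [seq tval t | t <- enum {: k.-tuple (link V)}] | k <- iota 0 n].

Lemma mem_configs_lt n c : (c \in configs_lt n) = (size c < n)%N.
Proof.
apply/flatten_mapP/idP => [[k] | cn].
  by rewrite mem_iota add0n => kn /mapP[t _ ->]; rewrite size_tuple.
by exists (size c); rewrite ?mem_iota //; apply/mapP; exists (in_tuple c); rewrite ?mem_enum.
Qed.

Lemma configs_lt_uniq n : uniq (configs_lt n).
Proof.
rewrite /configs_lt; elim: n 0%N => [|n IH] k //=.
rewrite cat_uniq IH andbT map_inj_uniq ?enum_uniq; last exact: val_inj.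
apply/hasPn => c /flatten_mapP[j]; rewrite mem_iota => /andP[kj _] /mapP[t _ ->].
apply/negP => /mapP[t' _ /(congr1 size)]; rewrite !size_tuple => jk.
by rewrite jk ltnn in kj.
Qed.

Lemma big_configs_lt (R : realType) n (F : config V -> R) :
  \sum_(c <- configs_lt n) F c = \sum_(0 <= k < n) \sum_(t : k.-tuple (link V)) F t.
Proof.
rewrite /configs_lt big_flatten big_map /index_iota subn0.
by apply: eq_bigr => k _; rewrite big_map big_enum.
Qed.

Definition simple c := all (fun l : link V => #|l.1| == 2%N) c.

Definition remove c i : config V := take i c ++ drop i.+1 c.

Lemma remove_split c i : (i < size c)%N ->
  c = take i c ++ nth (dummy_link V) c i :: drop i.+1 c.
Proof. by move=> ic; rewrite -drop_nth // cat_take_drop. Qed.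

Lemma size_remove c i : (i < size c)%N -> (size (remove c i)).+1 = size c.
Proof. by move=> ic; rewrite [in RHS](remove_split ic) !size_cat /= addnS. Qed.

Lemma Nlinks_remove c i g : (i < size c)%N ->
  Nlinks c g = (((nth (dummy_link V) c i).1 == g) + Nlinks (remove c i) g)%N.
Proof.
by move=> ic; rewrite {1}(remove_split ic) !(Nlinks_cat, Nlinks_cons) addnCA.
Qed.

Definition nremovable (Q : pred (config V)) f c :=
  count (fun i => ((nth (dummy_link V) c i).1 == f) && Q (remove c i)) (iota 0 (size c)).

Lemma Nlinks_count f c :
  Nlinks c f = count (fun i => (nth (dummy_link V) c i).1 == f) (iota 0 (size c)).
Proof.
have {1}-> : c = [seq nth (dummy_link V) c i | i <- iota 0 (size c)].
  by rewrite map_nth_iota0 // take_size.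
by rewrite /Nlinks count_map.
Qed.

Variable R : realType.
Variables beta u theta : R.
Hypotheses (hbeta : 0 < beta) (htheta : 0 < theta) (hu0 : 0 < u) (hu1 : u <= 1).

Local Notation W := (loop_weight beta u theta).
Local Notation th := (Num.max theta theta^-1).
Local Notation y := (beta * th).

Lemma loop_weight_ge0 c : 0 <= W c.
Proof.
rewrite /loop_weight !mulr_ge0 ?exprn_ge0 ?invr_ge0 ?ler0n ?subr_ge0 //.
- exact: ltW.
- exact: ltW.
- exact: ltW.
Qed.

Lemma max_inv_ge1 : 1 <= th.
Proof.
rewrite le_max; have [//|t1] := leP 1 theta.
by rewrite invf_ge1 // ltW ?orbT.
Qed.

Lemma rate_gt0 : 0 < y.
Proof. by rewrite mulr_gt0 // (lt_le_trans ltr01 max_inv_ge1). Qed.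

Lemma theta_pow (m n : nat) : (m <= n + 1)%N -> (n <= m + 1)%N -> theta ^+ m <= theta ^+ n * th.
Proof.
move=> mn nm; clear -mn nm htheta; have t0 : 0 <= theta by exact: ltW.
have [->|[->|mE]] : m = n \/ (m = n.+1 \/ n = m.+1) by lia.
- by rewrite ler_peMr ?max_inv_ge1 ?exprn_ge0.
- by rewrite exprSr ler_wpM2l ?exprn_ge0 // le_max lexx.
- rewrite mE exprSr -mulrA -[leLHS]mulr1 ler_wpM2l ?exprn_ge0 //.
  by rewrite -[leLHS](mulfV (lt0r_neq0 htheta)) ler_wpM2l // le_max lexx orbT.
Qed.

Lemma loop_weight_insert a z f s : #|f| = 2%N -> simple (a ++ z) ->
  W (a ++ (f, s) :: z) <=
  W (a ++ z) * (y / (size (a ++ z)).+1%:R) * (if s then u else 1 - u).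
Proof.
move=> f2 az; have [h1 h2] := nloops_insert s f2 az.
rewrite /loop_weight.
set k := nloops (a ++ (f, s) :: z) in h1 h2 *; set k' := nloops (a ++ z) in h1 h2 *.
have -> : size (a ++ (f, s) :: z) = (size (a ++ z)).+1 by rewrite !size_cat /= addnS.
set n := size (a ++ z).
have cE (p : pred (link V)) : count p (a ++ (f, s) :: z) = (p (f, s) + count p (a ++ z))%N.
  by rewrite !count_cat /= addnCA.
rewrite !cE /= factS natrM invfM.
set i1 := n.+1%:R^-1; set i2 := n`!%:R^-1.
set p := count _ (a ++ z); set q := count _ (a ++ z).
set A := beta ^+ n * i2 * u ^+ p * (1 - u) ^+ q * (beta * i1) * (if s then u else 1 - u).
have A0 : 0 <= A.
  have u0 : 0 <= u by exact: ltW.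
  have u1 : 0 <= 1 - u by rewrite subr_ge0.
  have b0 : 0 <= beta by exact: ltW.
  have i10 : 0 <= i1 by rewrite invr_ge0.
  have i20 : 0 <= i2 by rewrite invr_ge0.
  by rewrite /A !mulr_ge0 ?exprn_ge0 //; case: (s).
have -> : beta ^+ n.+1 * (i1 * i2) * u ^+ (s + p) * (1 - u) ^+ (~~ s + q) * theta ^+ k =
    A * theta ^+ k.
  rewrite /A; case: (s); rewrite ?add1n ?add0n !exprS; clear;
  move: (beta ^+ n) (u ^+ p) ((1 - u) ^+ q) (theta ^+ k) i1 i2 => *; ring.
have -> : beta ^+ n * i2 * u ^+ p * (1 - u) ^+ q * theta ^+ k' * (y * i1) *
    (if s then u else 1 - u) = A * (theta ^+ k' * th).
  rewrite /A; clear; move: (beta ^+ n) (u ^+ p) ((1 - u) ^+ q) (theta ^+ k') th i1 i2 (if s then u else _) => *; ring.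
by rewrite ler_wpM2l // theta_pow.
Qed.

(** The Mecke inequality. Removing a link while recording its position and type is injective. Over
    the [(size c).+1] slots and the two types, of weights [u] and [1 - u], the bounds of
    [loop_weight_insert] add up to the factor [y]. *)
Lemma removal_sum n f (Q : pred (config V)) : #|f| = 2%N ->
  (forall c, Q c -> simple c) ->
  \sum_(c <- configs_lt n) W c * (nremovable Q f c)%:R <= y * \sum_(c <- configs_lt n | Q c) W c.
Proof.
move=> f2 Qs.
pose ps := [seq (c, i) | c <- configs_lt n, i <- iota 0 (size c)].
pose js c := [seq (i, s) | i <- iota 0 (size c).+1, s <- [:: true; false]].
pose ts := [seq (c, j) | c <- configs_lt n, j <- js c].
pose us (s : bool) := if s then u else 1 - u.
have us0 s : 0 <= us s by rewrite /us; case: (s); rewrite ?subr_ge0 //; exact: ltW.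
have -> : \sum_(c <- configs_lt n) W c * (nremovable Q f c)%:R =
    \sum_(p <- ps | ((nth (dummy_link V) p.1 p.2).1 == f) && Q (remove p.1 p.2)) W p.1.
  rewrite [RHS]big_mkcond [RHS]big_allpairs_dep; apply: eq_bigr => c _ /=.
  by rewrite -[RHS]big_mkcond /= /nremovable -sum1_count natr_sum mulr_sumr; apply: eq_bigr => i _; rewrite mulr1.
have -> : y * \sum_(c <- configs_lt n | Q c) W c =
    \sum_(t <- ts | Q t.1) W t.1 * (y / (size t.1).+1%:R) * us t.2.2.
  rewrite [RHS]big_mkcond [RHS]big_allpairs_dep mulr_sumr [LHS]big_mkcond.
  apply: eq_bigr => c _ /=; case: (Q c); last by rewrite big1.
  rewrite big_allpairs_dep /=.
  under eq_bigr do rewrite !big_cons big_nil /= addr0 -mulrDr /us subrKC mulr1.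
  rewrite big_const_seq count_predT /= size_iota iter_addr_0 -mulrS -[RHS]mulr_natr.
  by move: (W c) => w; rewrite -!mulrA mulVf ?pnatr_eq0 // mulr1 mulrA mulrC.
apply: (@ler_sum_inj _ _ _ _ _ _ _ _ _ (fun p => (remove p.1 p.2, (p.2, (nth (dummy_link V) p.1 p.2).2)))).
- by apply: allpairs_uniq_dep => [|c _|]; rewrite ?configs_lt_uniq ?iota_uniq // => -[c i] [c' i'] _ _ [-> ->].
- apply: allpairs_uniq_dep => [|c _|]; rewrite ?configs_lt_uniq //; last by move=> [c i] [c' i'] _ _ [-> ->].
  by apply: allpairs_uniq_dep => [|i _|]; rewrite ?iota_uniq // => -[i b] [i' b'] _ _ [-> ->].
- move=> _ /allpairsPdep[c [i [cn ic ->]]] /= /andP[/eqP fi Qr].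
  have ic' : (i < size c)%N by move: ic; rewrite mem_iota.
  have sr := size_remove ic'.
  split => //.
    apply: allpairs_f_dep.
      by move: cn; rewrite !mem_configs_lt -sr => /ltnW.
    apply: allpairs_f_dep; last by case: (_.2).
    by rewrite mem_iota add0n sr.
  rewrite {1}(remove_split ic'); case E: (nth _ c i) fi => [f' s] /= ->.
  exact: loop_weight_insert f2 (Qs _ Qr).
- move=> p p' /allpairsPdep[c [i [_ ic ->]]] /= /andP[/eqP fi _].
  move=> /allpairsPdep[c' [i' [_ ic' ->]]] /= /andP[/eqP fi' _] [e1 e2 e3].
  move: ic ic'; rewrite !mem_iota /= -e2 => ic ic'; congr (_, _).
  have s1 : size (take i c) = i by rewrite size_takel // ltnW.
  have s2 : size (take i c') = i by rewrite size_takel // ltnW.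
  move: e1; rewrite /remove -e2 => /eqP; rewrite eqseq_cat ?s1 ?s2 // => /andP[/eqP t1 /eqP t2].
  rewrite (remove_split ic) (remove_split ic') t1 t2; congr (_ ++ _ :: _).
  move: fi fi' e3; rewrite -e2; case: (nth _ c i) => ? ?; case: (nth _ c' i) => ? ?.
  by move=> /= -> -> ->.
- move=> [c [i s]] /= _; apply: mulr_ge0; last exact: us0.
  by apply: mulr_ge0; [exact: loop_weight_ge0 | rewrite divr_ge0 // ltW // rate_gt0].
Qed.

End Weights.

Lemma sum_exp_coeff_le (R : realType) (n : nat) (x : R) : 0 <= x ->
  \sum_(0 <= m < n) x ^+ m / m`!%:R <= expR x.
Proof.
move=> x0; rewrite /expR.
apply: (@nondecreasing_cvgn_le R (series (exp_coeff x))); last exact: is_cvg_series_exp_coeff.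
by apply: nondecreasing_series => k _ _; rewrite /exp_coeff /= divr_ge0 ?exprn_ge0.
Qed.

(** * Deleting links under prescribed blocking statuses *)

Section Conditioning.
Variable V : finType.
Implicit Types (a c z : config V) (e f g : {set V}) (U H G b : {set {set V}}) (n : nat).

Lemma erase_remove e c i : (i < size c)%N -> (nth (dummy_link V) c i).1 = e ->
  erase e (remove c i) = erase e c.
Proof.
move=> ic ie; rewrite [in RHS](remove_split ic) /erase /remove !filter_cat /=.
by rewrite ie eqxx.
Qed.

Lemma nremovable_all (Q : pred (config V)) f c :
  (forall i, (i < size c)%N -> (nth (dummy_link V) c i).1 = f -> Q (remove c i)) ->
  nremovable Q f c = Nlinks c f.
Proof.
move=> h; rewrite Nlinks_count /nremovable; apply: eq_in_count => i.
rewrite mem_iota => /= ic; apply: andb_idr => /eqP; exact: h.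
Qed.

Lemma simple_erase e c : #|e| = 2%N -> simple (erase e c) = simple c.
Proof.
move=> e2; rewrite /simple all_filter; apply: eq_all => l /=.
by case: eqP => //= ->; rewrite e2.
Qed.

(** Statuses are prescribed on [H] only; an edge of [U] outside [H] must carry a link, but may be
    blocking or not. *)
Definition outcome U H b : pred (config V) := fun c =>
  cond_event U c && [forall h in H, blocking c h == (h \in b)].

Lemma outcomeP U H b c : reflect
  [/\ forall l, l \in c -> l.1 \in U, forall g, g \in U -> (0 < Nlinks c g)%N &
      forall h, h \in H -> blocking c h = (h \in b)] (outcome U H b c).
Proof.
apply: (iffP andP) => [[/andP[/allP cU /forall_inP cN] /forall_inP cH]|[cU cN cH]].
  by split => // h hH; apply/eqP; exact: cH.
split; last by apply/forall_inP => h hH; rewrite cH.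
by apply/andP; split; [apply/allP | apply/forall_inP].
Qed.

Lemma mem_remove c i (l : link V) : l \in remove c i -> l \in c.
Proof. by rewrite mem_cat => /orP[/mem_take|/mem_drop]. Qed.

Variable R : realType.
Variables beta u theta : R.
Hypotheses (hbeta : 0 < beta) (htheta : 0 < theta) (hu0 : 0 < u) (hu1 : u <= 1).

Local Notation W := (loop_weight beta u theta).
Local Notation y := (beta * Num.max theta theta^-1).
Local Notation SW n P := (\sum_(c <- configs_lt V n | P c) W c).

Let W0 (c : config V) : 0 <= W c := loop_weight_ge0 hbeta htheta hu0 hu1 c.
Let y0 : 0 < y := rate_gt0 hbeta htheta.

Lemma weight_sum_sub n (P Q : pred (config V)) : (forall c, P c -> Q c) -> SW n P <= SW n Q.
Proof.
move=> PQ; rewrite [leLHS]big_mkcond [leRHS]big_mkcond /=; apply: ler_sum => c _.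
by case: (boolP (P c)) => [/PQ ->//|_]; case: ifP.
Qed.

(** Let [T m] collect the configurations with [m] links on [e]. Any of [m.+1] links may be removed,
    so T(m+1) (m+1) <= y T(m) and T(m) <= y^m/m! T(0); summing over m >= 1 gives the exponential
    series without its first term. *)
Lemma erase_sum n e (Q : pred (config V)) : #|e| = 2%N -> (forall c, Q c -> simple c) ->
  SW n (fun c => Q (erase e c) && (0 < Nlinks c e)%N) <= (expR y - 1) * SW n Q.
Proof.
move=> e2 Qs; pose T m := SW n (fun c => Q (erase e c) && (Nlinks c e == m)).
have step m : T m.+1 * m.+1%:R <= y * T m.
  apply: le_trans (removal_sum hbeta htheta hu0 hu1 n e2
    (Q := fun c => Q (erase e c) && (Nlinks c e == m)) _); last first.
    by move=> c /andP[/Qs]; rewrite simple_erase.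
  rewrite /T mulr_suml big_mkcond; apply: ler_sum => c _.
  case: ifP => [/andP[Qc /eqP ce]|_]; last by rewrite mulr_ge0.
  rewrite nremovable_all ?ce // => i ic ie.
  rewrite erase_remove // Qc; have := Nlinks_remove e ic.
  by rewrite ce ie eqxx add1n => -[->] /=.
have bound m : T m <= y ^+ m / m`!%:R * T 0%N.
  elim: m => [|m IH]; first by rewrite expr0 divr1 mul1r.
  rewrite -(ler_pM2r (ltr0Sn R m)); apply: le_trans (step m) _.
  apply: le_trans (ler_wpM2l (ltW y0) IH) _.
  have m0 : m.+1%:R != 0 :> R by rewrite pnatr_eq0.
  have f0 : m`!%:R != 0 :> R by rewrite pnatr_eq0 -lt0n fact_gt0.
  rewrite exprS factS natrM le_eqVlt; apply/orP; left; apply/eqP.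
  clear step IH; move: (y ^+ m) (T 0%N) (y) m.+1%:R m`!%:R m0 f0 => p t x k j k0 j0.
  by field; rewrite k0 j0.
have T0 : T 0%N <= SW n Q.
  apply: weight_sum_sub => c /andP[+ /eqP ce]; rewrite /erase (all_filterP _) //.
  rewrite -[all _ _]negbK -has_predC; apply/negP => hc.
  have : (0 < Nlinks c e)%N.
    by rewrite -has_count; apply: sub_has hc => l /=; rewrite negbK.
  by rewrite ce.
have split_sum : SW n (fun c => Q (erase e c) && (0 < Nlinks c e)%N) <=
    \sum_(1 <= m < n.+1) T m.
  rewrite /T; under [leRHS]eq_bigr do rewrite big_mkcond.
  rewrite exchange_big [leLHS]big_mkcond [leLHS]big_seq [leRHS]big_seq; apply: ler_sum => c; rewrite mem_configs_lt => cn /=.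
  have pos m : 0 <= (if Q (erase e c) && (Nlinks c e == m) then W c else 0).
    by case: ifP.
  case: ifP => [/andP[Qc ce]|_]; last exact: sumr_ge0.
  rewrite (bigD1_seq (Nlinks c e)) ?iota_uniq //=; last first.
    rewrite mem_index_iota ce /= ltnS ltnW //; apply: leq_ltn_trans cn; exact: count_size.
  by rewrite Qc eqxx /= lerDl; apply: sumr_ge0 => m _; case: ifP.
apply: le_trans split_sum _.
apply: (@le_trans _ _ (\sum_(1 <= m < n.+1) y ^+ m / m`!%:R * T 0%N)).
  by apply: ler_sum => m _.
rewrite -mulr_suml; have T00 : 0 <= T 0%N by apply: sumr_ge0.
apply: ler_pM => //.
  by apply: sumr_ge0 => m _; rewrite divr_ge0 ?exprn_ge0 // ltW.
have := sum_exp_coeff_le n.+1 (ltW y0); rewrite big_ltn // expr0 divr1.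
by rewrite lerBrDl.
Qed.

Lemma outcome_simple U H b : (forall e, e \in U -> #|e| = 2%N) ->
  forall c, outcome U H b c -> simple c.
Proof.
by move=> U2 c /outcomeP[cU _ _]; apply/allP => l /cU /U2 ->.
Qed.

Lemma blocking_remove c i f : #|f| = 2%N -> (i < size c)%N ->
  (nth (dummy_link V) c i).1 = f -> blocking c f ->
  forall h, blocking (remove c i) h = (h != f) && blocking c h.
Proof.
move=> f2 ic fi bf h; have [->|hf] /= := eqVneq h f.
  apply/negP => /blocking_Nlinks; have := Nlinks_remove f ic.
  by rewrite fi eqxx (blocking_Nlinks bf); lia.
rewrite [in RHS](remove_split ic); apply: blocking_remove_edge f2 fi hf _.
by rewrite -remove_split.
Qed.

(** If [g] is blocking, either of its two crosses may be removed; one link remains and [g] is no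
    longer blocking. The two choices account for the 2 in y/2. *)
Lemma one_edge_free n U H b g : (forall e, e \in U -> #|e| = 2%N) ->
  H \subset U -> g \in H -> g \notin b ->
  SW n (outcome U (H :\ g) b) <= (1 + y / 2) * SW n (outcome U H b).
Proof.
move=> U2 HU gH gb; have gU := fintype.subsetP HU _ gH.
pose P c := outcome U (H :\ g) b c && blocking c g.
apply: (@le_trans _ _ (SW n (outcome U H b) + SW n P)).
  rewrite [leLHS]big_mkcond [X in _ <= X + _]big_mkcond [X in _ <= _ + X]big_mkcond -big_split /=; apply: ler_sum => c _.
  case: ifP => [oc|_]; last by rewrite addr_ge0 //; case: ifP.
  rewrite /P oc /=; case: (boolP (blocking c g)) => bg /=.
    by rewrite lerDr; case: ifP.
  suff -> : outcome U H b c by rewrite lerDl.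
  move/outcomeP: oc => [cU cN cH]; apply/outcomeP; split => // h hH.
  have [->|hg] := eqVneq h g; first by rewrite (negPf bg) (negPf gb).
  by rewrite cH // !inE hg.
rewrite mulrDl mul1r lerD2l -(ler_pM2r (ltr0Sn R 1)).
rewrite (_ : y / 2 * _ * 2 = y * SW n (outcome U H b)); last first.
  by rewrite mulrAC -(mulrA y) mulVf ?mulr1 // pnatr_eq0.
apply: le_trans (removal_sum hbeta htheta hu0 hu1 n (U2 _ gU) (outcome_simple U2 (H := H) (b := b))).
rewrite mulr_suml big_mkcond; apply: ler_sum => c _.
case: ifP => [/andP[oc bg]|_]; last by rewrite mulr_ge0.
rewrite nremovable_all ?(blocking_Nlinks bg) // => i ic ig.
move/outcomeP: oc => [cU cN cH]; apply/outcomeP; split.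
- by move=> l /mem_remove /cU.
- move=> h hU; have := Nlinks_remove h ic; rewrite ig; case: eqVneq => [<-|hg].
    by rewrite (blocking_Nlinks bg) /=; lia.
  by rewrite add0n => <-; exact: cN.
- move=> h hH; rewrite (blocking_remove (U2 _ gU) ic ig bg).
  by case: eqVneq => [->|hg] /=; [rewrite (negPf gb) | apply: cH; rewrite !inE hg].
Qed.

Lemma edges_free n U H b G : (forall e, e \in U -> #|e| = 2%N) ->
  H \subset U -> G \subset H -> [disjoint G & b] ->
  SW n (outcome U (H :\: G) b) <= (1 + y / 2) ^+ #|G| * SW n (outcome U H b).
Proof.
move=> U2 HU; move Gk : #|G| => k; elim: k G Gk => [|k IH] G Gk GH Gb.
  by move/eqP: Gk; rewrite cards_eq0 => /eqP ->; rewrite finset.setD0 expr0 mul1r.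
have /finset.set0Pn[g gG] : G != finset.set0 by rewrite -card_gt0 Gk.
have sub : G :\ g \subset G by exact: finset.subD1set.
have := IH (G :\ g); rewrite (cardsD1 g G) gG add1n in Gk; case: Gk => Gk /(_ Gk).
move=> /(_ (fintype.subset_trans sub GH) (disjointWl sub Gb)) IHk.
rewrite exprS -mulrA; apply: le_trans (ler_wpM2l _ IHk); last first.
  by rewrite addr_ge0 // divr_ge0 // ltW.
have -> : H :\: G = (H :\: (G :\ g)) :\ g.
  apply/finset.setP => h; rewrite !inE; case: eqVneq => [->|_] //=.
  by rewrite gG.
apply: one_edge_free => //.
- by apply: fintype.subset_trans HU; exact: finset.subsetDl.
- by rewrite !inE eqxx (fintype.subsetP GH).
- by rewrite (disjointFr Gb gG).
Qed.

(** Erasing the links on [e] can only make further edges blocking, and only edges that meet [e] and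
    are not in [b]; the statuses of these edges are released. *)
Lemma erase_outcome n U b e : (forall e, e \in U -> #|e| = 2%N) -> e \in U ->
  SW n (outcome U (U :\ e) b) <= (expR y - 1) *
    SW n (outcome (U :\ e) ((U :\ e) :\: [set g in U | (e :&: g != finset.set0) && (g \notin b)]) b).
Proof.
move=> U2 eU; apply: le_trans (erase_sum n (U2 _ eU) _); last first.
  by apply: outcome_simple => g; rewrite inE => /andP[_ /U2].
apply: weight_sum_sub => c /outcomeP[cU cN cH]; rewrite (cN e eU) andbT; apply/outcomeP; split.
- by move=> l; rewrite mem_filter !inE => /andP[-> /cU].
- by move=> g; rewrite !inE => /andP[ge gU]; rewrite Nlinks_erase // cN.
move=> h; rewrite !inE => /and3P[hF he hU].
have ch : blocking c h = (h \in b) by rewrite cH // !inE he.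
move: hF; rewrite hU /= negb_and !negbK => /orP[/eqP eh|hb].
  by rewrite blocking_erase_disjoint.
by rewrite hb blocking_erase // ch.
Qed.

Lemma mean_links n U b f (D : nat) : (forall e, e \in U -> #|e| = 2%N) -> f \in U ->
  f \notin b -> (#|[set g in U :\ f | f :&: g != finset.set0]| <= D)%N ->
  \sum_(c <- configs_lt V n | outcome U U b c) W c * (Nlinks c f)%:R <=
  ((D + 3)%:R + y) * SW n (outcome U U b).
Proof.
move=> U2 fU fb hD; rewrite mulrDl.
apply: le_trans (lerD (lexx _) (removal_sum hbeta htheta hu0 hu1 n (U2 _ fU)
  (outcome_simple U2 (H := U) (b := b)))).
rewrite mulr_sumr big_mkcond [X in _ <= X + _]big_mkcond -big_split /=; apply: ler_sum => c _.
case: ifP => [oc|_]; last by rewrite add0r mulr_ge0.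
rewrite [(D + 3)%:R * _]mulrC -mulrDr -natrD ler_wpM2l // ler_nat.
(* From four links on, a removal leaves at least three, so [f] keeps a link and stays non-blocking.
   Up to three links are paid by the summand 3. *)
have [|N4] := leqP (Nlinks c f) 3; first by lia.
set Q := outcome U U b in oc *.
(* Every adjacent edge g accounts for at most one critical link: the only link
   touching g between the two crosses on g. *)
pose crit i := ((nth (dummy_link V) c i).1 == f) && ~~ Q (remove c i).
have -> : Nlinks c f = (count crit (iota 0 (size c)) + nremovable Q f c)%N.
  rewrite Nlinks_count /nremovable -count_predUI.
  rewrite [X in (_ + X)%N](@eq_count _ _ pred0) ?count_pred0 ?addn0; last first.
    by move=> i /=; rewrite /crit; case: (Q _); rewrite ?andbF.
  by apply: eq_count => i /=; rewrite /crit -andb_orr orNb andbT.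
rewrite leq_add2r; apply: leq_trans (leq_trans hD (leq_addr 3 D)).
have /outcomeP[cU cN cH] := oc.
have critP i : (i < size c)%N -> crit i ->
    [exists g in [set g in U :\ f | f :&: g != finset.set0], blocking (remove c i) g && ~~ blocking c g].
  move=> ic /andP[/eqP fi]; apply: contraR => /exists_inPn nb.
  have nf := Nlinks_remove f ic; rewrite fi eqxx in nf.
  apply/outcomeP; split.
  - by move=> l /mem_remove /cU.
  - move=> h hU; have := Nlinks_remove h ic; rewrite fi; case: eqVneq => [<-|hf]; first by lia.
    by rewrite add0n => <-; exact: cN.
  - move=> h hU; have [->|hf] := eqVneq h f.
      rewrite (negPf fb); apply/negP => /blocking_Nlinks; lia.
    have fh : (nth (dummy_link V) c i).1 != h by rewrite fi eq_sym.
    rewrite -(cH h hU); apply/idP/idP => [br|]; last first.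
      by rewrite {1}(remove_split ic) blocking_insert // => /andP[].
    apply/negPn/negP => nbc; have [fh0|fh1] := eqVneq (f :&: h) finset.set0.
      move/negP: nbc; apply; rewrite (remove_split ic) blocking_insert //.
      by rewrite [blocking _ _]br /touch fi fh0 eqxx andbF.
    have hF : h \in [set g in U :\ f | f :&: g != finset.set0] by rewrite !inE hf hU.
    by have := nb h hF; rewrite br nbc.
(* An edge that the removal of link [i] makes blocking; the default [f] never occurs at a critical
   index. *)
pose ph i := odflt f [pick g in [set g in U :\ f | f :&: g != finset.set0] |
  blocking (remove c i) g && ~~ blocking c g].
have phP i : (i < size c)%N -> crit i -> [/\ ph i \in [set g in U :\ f | f :&: g != finset.set0],
    blocking (remove c i) (ph i) & ~~ blocking c (ph i)].
  move=> ic /(critP _ ic)/exists_inP[g gF gb]; rewrite /ph; case: pickP => [h /and3P[]//|].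
  by move/(_ g); rewrite gF gb.
rewrite -size_filter -(size_map ph) cardE; apply: uniq_leq_size; last first.
  move=> _ /mapP[i + ->]; rewrite mem_filter mem_iota mem_enum => /andP[ci /= ic].
  by have [] := phP i ic ci.
(* Two critical links with a common witness would, by [blocking_critical], make the witness blocking
   in [c] itself. *)
have noboth i j : (i < j < size c)%N -> crit i -> crit j -> ph i <> ph j.
  move=> /andP[ij jc] ci cj; have ic := ltn_trans ij jc.
  have [gF bi nb] := phP i ic ci; have [_ + _] := phP j jc cj => /[swap] <- bj.
  have /andP[/eqP fi _] := ci; have /andP[/eqP fj _] := cj.
  move/negP: nb; apply; move: gF; rewrite !inE => /andP[/andP[hf _] _].
  have ce := remove_split ic; move: bi; rewrite /remove.
  set d := drop i.+1 c in ce *; set a := take i c in ce *.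
  have sa : size a = i by rewrite size_takel // ltnW.
  pose k := (j - i.+1)%N; have kd : (k < size d)%N by rewrite size_drop ltn_sub2r // (leq_ltn_trans ij).
  have jE : j = (i.+1 + k)%N by rewrite subnKC.
  have nj : nth (dummy_link V) c j = nth (dummy_link V) d k by rewrite nth_drop -jE.
  rewrite (remove_split kd) -nj => bi; rewrite ce (remove_split kd) -nj.
  apply: blocking_critical; rewrite ?fi ?fj //; first by rewrite eq_sym.
  move: bj; rewrite /remove {1}ce take_cat sa ltnNge ltnW //=.
  rewrite (_ : j - i = k.+1)%N /=; last by lia.
  by rewrite -catA /= (_ : drop j.+1 c = drop k.+1 d) // drop_drop; congr drop; lia.
rewrite map_inj_in_uniq ?filter_uniq ?iota_uniq // => i j.
rewrite !mem_filter !mem_iota /= => /andP[ci ic] /andP[cj jc] pij.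
apply/eqP; case: ltngtP => // [ij|ji].
  by case: (noboth i j); rewrite ?ij.
by case: (noboth j i); rewrite ?ji.
Qed.

End Conditioning.

(** * Free slots *)

Section Swaps.
Variable V : finType.
Implicit Types (a c z : config V) (e f g h : {set V}) (U b : {set {set V}}) (n : nat) (v w : V).

Lemma untouched_mem (m : config V) g v : all (fun l : link V => ~~ touch l g) m -> v \in g ->
  all (fun l : link V => v \notin l.1) m.
Proof.
move=> mg vg; apply: sub_all mg => l; rewrite negbK => /eqP lg.
by apply/negP => vl; move/finset.setP/(_ v): lg; rewrite !inE vl vg.
Qed.

Lemma Nlinks_avoid (m : config V) g v : all (fun l : link V => v \notin l.1) m -> v \in g ->
  Nlinks m g = 0%N.
Proof.
move=> mg vg; apply/eqP; rewrite -leqn0 leqNgt; apply/negP => /Nlinks_first.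
by case=> [a1 [l [a2 [me lg _]]]]; move: mg; rewrite me all_cat /= lg vg andbF.
Qed.

Lemma blocking_cross c g (l : link V) : blocking c g -> l \in c -> l.1 = g -> l = (g, true).
Proof.
by case/and3P => _ /allP h _ lc lg; move: (h l lc); rewrite lg eqxx /=; case: l lg {lc} => /= ? [] // ->.
Qed.

Lemma blocking_prefix a z g : #|g| = 2%N -> blocking (a ++ z) g -> Nlinks a g = 1%N ->
  exists a1 a2, [/\ a = a1 ++ (g, true) :: a2, Nlinks a1 g = 0%N &
                    all (fun l : link V => ~~ touch l g) a2].
Proof.
move=> g2 bg a1; have /Nlinks_first[b1 [l [b2 [ae lg b10]]]] : (0 < Nlinks a g)%N by rewrite a1.
have lE : l = (g, true) by apply: blocking_cross bg _ lg; rewrite ae !mem_cat mem_head orbT.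
exists b1, b2; rewrite -lE; split => //.
have b20 : Nlinks b2 g = 0%N by move: a1; rewrite ae Nlinks_cat Nlinks_cons lg eqxx b10; lia.
move: bg; rewrite blockingE => /and3P[_ _ /unbarredP ug].
apply/allP => k /path.splitPr kb; case: kb ae b20 => m1 m2 ae.
rewrite Nlinks_cat Nlinks_cons => m0; apply: (ug (b1 ++ l :: m1) k (m2 ++ z)).
- by rewrite ae -!catA /= -?catA.
- by apply/negP => kg; rewrite kg in m0; lia.
- by rewrite Nlinks_cat Nlinks_cons lg eqxx b10; lia.
Qed.

Lemma blocking_suffix a z g : #|g| = 2%N -> blocking (a ++ z) g -> Nlinks a g = 1%N ->
  exists z1 z2, [/\ z = z1 ++ (g, true) :: z2, Nlinks z1 g = 0%N &
                    all (fun l : link V => ~~ touch l g) z1].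
Proof.
move=> g2 bg a1; have nz := blocking_Nlinks bg.
have /Nlinks_first[z1 [l [z2 [ze lg z10]]]] : (0 < Nlinks z g)%N.
  by move: nz; rewrite Nlinks_cat a1; lia.
have lE : l = (g, true).
  by apply: blocking_cross bg _ lg; rewrite ze !mem_cat mem_head !orbT.
exists z1, z2; rewrite -lE; split => //.
by rewrite ze in bg; have [] := blocking_move g2 lg a1 z10 bg.
Qed.

(** A slot is a pair of prefix and suffix. Since edges of [b] carry two links, the prefix alone
    tells whether the slot lies between them. *)
Definition covered b v a := [exists g in b, (v \in g) && (Nlinks a g == 1%N)].

Definition free_slot b e a := ~~ [exists g in b, (g :&: e != finset.set0) && (Nlinks a g == 1%N)].

(** The potential that bounds the iteration: every exchange lowers it. *)
Definition pending b e z := #|[set g in b | (g :&: e != finset.set0) && (0 < Nlinks z g)%N]|.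

Lemma free_slotE b v w a : free_slot b [set v; w] a = ~~ (covered b v a || covered b w a).
Proof.
congr negb; apply/exists_inP/orP => [[g gb /andP[/finset.set0Pn[x]]]|].
  rewrite !inE => /andP[xg /orP[/eqP xv|/eqP xw]] a1; [left|right];
  by apply/exists_inP; exists g; rewrite // -?xv -?xw xg.
by case=> /exists_inP[g gb /andP[vg a1]]; exists g; rewrite ?a1 // andbT;
  apply/finset.set0Pn; [exists v | exists w]; rewrite !inE vg eqxx ?orbT.
Qed.

(* Exchanges the slot with the first link through [v] after it; when the slot is
   covered, this is the second cross of the covering edge. *)
Definition advance v (s : config V * config V) : config V * config V :=
  let k := find (fun l : link V => v \in l.1) s.2 in
  (s.1 ++ nth (dummy_link V) s.2 k :: take k s.2, drop k.+1 s.2).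

Lemma advanceE v a z1 (l : link V) z2 : all (fun l : link V => v \notin l.1) z1 -> v \in l.1 ->
  advance v (a, z1 ++ l :: z2) = (a ++ l :: z1, z2).
Proof.
move=> z1v vl; rewrite /advance /=.
have -> : find (fun l : link V => v \in l.1) (z1 ++ l :: z2) = size z1.
  have hz : has (fun l : link V => v \in l.1) z1 = false.
    by apply/negbTE; rewrite -all_predC.
  by rewrite find_cat hz /= vl addn0.
have -> : drop (size z1).+1 (z1 ++ l :: z2) = z2.
  by rewrite -cat_rcons drop_size_cat ?size_rcons.
by rewrite nth_cat ltnn subnn take_size_cat.
Qed.

(** Decodes [advance]: after the exchange, the cross next to the old slot is the last link through
    [v] before the new slot. *)
Lemma last_hit_inj (T : eqType) (P : pred T) (a a' m m' : seq T) (x x' : T) :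
  all (predC P) m -> all (predC P) m' -> P x -> P x' ->
  a ++ x :: m = a' ++ x' :: m' -> [/\ a = a', x = x' & m = m'].
Proof.
elim/last_ind: m m' => [|m y IH] m'.
  case/lastP: m' => [|m' y'] _; rewrite !cats1.
    by move=> _ _ _ /rcons_inj[-> ->].
  rewrite all_rcons => /andP[/= y'P _] Px _; rewrite -rcons_cons -rcons_cat.
  by move/rcons_inj => [_ yx]; rewrite yx (negPf y'P) in Px.
rewrite all_rcons => /andP[/= yP mP]; rewrite -rcons_cons -rcons_cat.
case/lastP: m' => [|m' y'] m'P Px Px'.
  by rewrite cats1 => /rcons_inj[_ yx]; rewrite -yx (negPf yP) in Px'.
move: m'P; rewrite all_rcons => /andP[_ m'P]; rewrite -rcons_cons -rcons_cat.
by move=> /rcons_inj[/(IH _ mP m'P Px Px')[-> -> ->] ->].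
Qed.

Section Outcome.
Variables (U b : {set {set V}}).
Hypothesis U2 : forall e, e \in U -> #|e| = 2%N.
Hypothesis bU : b \subset U.

Lemma covered_split v a z : outcome U U b (a ++ z) -> covered b v a ->
  exists g a1 a2 z1 z2, [/\ g \in b, v \in g,
    a = a1 ++ (g, true) :: a2 & z = z1 ++ (g, true) :: z2] /\
    [/\ Nlinks a1 g = 0%N, all (fun l : link V => ~~ touch l g) a2 &
        all (fun l : link V => ~~ touch l g) z1].
Proof.
move=> /outcomeP[_ _ cH] /exists_inP[g gb /andP[vg /eqP ag]].
have gU := fintype.subsetP bU _ gb; have bg : blocking (a ++ z) g by rewrite cH.
have [a1 [a2 [ae a10 a2g]]] := blocking_prefix (U2 gU) bg ag.
have [z1 [z2 [ze _ z1g]]] := blocking_suffix (U2 gU) bg ag.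
by exists g, a1, a2, z1, z2.
Qed.

Lemma covered_advance v e a z : outcome U U b (a ++ z) -> covered b v a -> v \in e ->
  let s := advance v (a, z) in
  [/\ outcome U U b (s.1 ++ s.2), ~~ covered b v s.1,
      (pending b e s.2 < pending b e z)%N & size (s.1 ++ s.2) = size (a ++ z)] /\
  nloops (s.1 ++ s.2) = nloops (a ++ z) /\ perm_eq (s.1 ++ s.2) (a ++ z).
Proof.
move=> oc cov ve; have [g [a1 [a2 [z1 [z2 []]]]]] := covered_split oc cov.
move=> [gb vg ae ze] [a10 a2g z1g] s.
have gU := fintype.subsetP bU _ gb; have g2 := U2 gU.
have sE : s = (a ++ (g, true) :: z1, z2).
  by rewrite /s ze advanceE //; exact: untouched_mem z1g vg.
clearbody s.
have /outcomeP[cU cN cH] := oc; have bg : blocking (a ++ z) g by rewrite cH.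
have a2n := Nlinks_untouched g2 a2g; have z1n := Nlinks_untouched g2 z1g.
have ag : Nlinks a g = 1%N by rewrite ae Nlinks_cat Nlinks_cons eqxx a10 a2n.
have pe : perm_eq (s.1 ++ s.2) (a ++ z).
  by rewrite sE ze /= -catA perm_cat2l /= perm_sym -cat1s perm_catCA.
have NE h : Nlinks (s.1 ++ s.2) h = Nlinks (a ++ z) h by rewrite /Nlinks; move/seq.permP: pe => ->.
have bE h : blocking (s.1 ++ s.2) h = blocking (a ++ z) h.
  have := bg; rewrite ze => bg'.
  have [_ mE] := blocking_move g2 (erefl g : (g, true).1 = g) ag z1n bg'.
  by rewrite sE /= -catA mE -ze.
split; [split|split] => //.
- apply/outcomeP; split => [l|h hU|h hU]; last by rewrite bE cH.
    by rewrite (perm_mem pe) => /cU.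
  by rewrite NE cN.
(* No link between the crosses on [g] passes through [v]. So an edge [h] covering [v] at the new
   slot would have exactly one link before the first cross on [g]; this cross would lie between the
   links on [h] and touch [h]. *)
- apply/negP => /exists_inP[h hb /andP[vh]]; rewrite sE /= Nlinks_cat Nlinks_cons.
  have z1h := Nlinks_avoid (untouched_mem z1g vg) vh.
  have a2h := Nlinks_avoid (untouched_mem a2g vg) vh.
  rewrite z1h /=; have [hg|hg] := eqVneq g h; first by rewrite -hg ag.
  rewrite ae Nlinks_cat Nlinks_cons a2h /= (negPf hg) !addn0 => a1h.
  have hU := fintype.subsetP bU _ hb; have : blocking (a ++ z) h by rewrite cH.
  rewrite ae -catA /= blocking_insert // a1h => /andP[_] /=.
  by rewrite negbK => /eqP/finset.setP/(_ v); rewrite !inE vg vh.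
- apply: proper_card; apply/fintype.properP; split.
    apply/fintype.subsetP => h; rewrite !inE sE ze /= Nlinks_cat Nlinks_cons.
    by case/and3P => -> -> /= z2h; rewrite !addn_gt0 z2h !orbT.
  exists g; rewrite !inE gb /=.
    rewrite ze Nlinks_cat Nlinks_cons eqxx addnCA andbT.
    by apply/finset.set0Pn; exists v; rewrite !inE vg ve.
  have : Nlinks z2 g = 0%N.
    by have := blocking_Nlinks bg; rewrite Nlinks_cat ag ze Nlinks_cat Nlinks_cons eqxx z1n => -[].
  by rewrite sE /= => ->; rewrite !andbF.
- exact: perm_size.
(* Before and after the exchange, cancelling both crosses on [g] leaves the same configuration. *)
rewrite sE ze ae /= -!catA /= -?catA.
have ut m : all (fun l : link V => ~~ touch l g) m -> all (fun l : link V => l.1 :&: g == finset.set0) m.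
  by apply: sub_all => l; rewrite negbK.
rewrite (nloops_pair _ _ g2 (ut _ a2g)) [in RHS]catA.
by rewrite (@nloops_pair _ _ a1 (a2 ++ z1)) -?catA // all_cat !ut.
Qed.

Lemma advance_inj v a z a' z' : outcome U U b (a ++ z) -> covered b v a ->
  outcome U U b (a' ++ z') -> covered b v a' ->
  advance v (a, z) = advance v (a', z') -> (a, z) = (a', z').
Proof.
move=> oc cov oc' cov'.
have [g [a1 [a2 [z1 [z2 []]]]]] := covered_split oc cov.
have [g' [a1' [a2' [z1' [z2' []]]]]] := covered_split oc' cov'.
move=> [gb' vg' ae' ze'] [a10' a2g' z1g'] [gb vg ae ze] [a10 a2g z1g].
have zv := untouched_mem z1g vg; have zv' := untouched_mem z1g' vg'.
rewrite ze ze' !advanceE // => -[].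
by case/(@last_hit_inj _ (fun l : link V => v \in l.1) a a' z1 z1' (g, true) (g', true)
  zv zv' vg vg') => -> -> -> ->.
Qed.

End Outcome.
End Swaps.

(** * The share of free slots *)

Section SwapSums.
Variable V : finType.
Implicit Types (a c z : config V) (e f g h : {set V}) (U b : {set {set V}}) (n : nat) (v w : V).

Definition splits n : seq (config V * config V) :=
  [seq (take p c, drop p c) | c <- configs_lt V n, p <- iota 0 (size c).+1].

Lemma mem_splits n a z : ((a, z) \in splits n) = (size (a ++ z) < n)%N.
Proof.
apply/allpairsPdep/idP => [[c [p [cn _ [-> ->]]]]|az].
  by rewrite cat_take_drop -mem_configs_lt.
exists (a ++ z), (size a); rewrite mem_configs_lt mem_iota size_cat add0n ltnS leq_addr.
by rewrite -size_cat take_size_cat // drop_size_cat.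
Qed.

Lemma splits_uniq n : uniq (splits n).
Proof.
apply: allpairs_uniq_dep => [|c _|]; rewrite ?configs_lt_uniq ?iota_uniq //.
move=> s s' /allpairsPdep[c [p [_ + ->]]] /allpairsPdep[c' [p' [_ + ->]]] [].
rewrite !mem_iota !ltnS /= => pc pc' tt dd; have cc : c = c'.
  by rewrite -(cat_take_drop p c) -(cat_take_drop p' c') tt dd.
by rewrite -cc in pc' tt *; move: (congr1 size tt); rewrite !size_takel // => ->.
Qed.

Variable R : realType.
Variables beta u theta : R.
Hypotheses (hbeta : 0 < beta) (htheta : 0 < theta) (hu0 : 0 < u) (hu1 : u <= 1).

Local Notation W := (loop_weight beta u theta).
Let W0 (c : config V) : 0 <= W c := loop_weight_ge0 hbeta htheta hu0 hu1 c.

Lemma loop_weight_perm (c c' : config V) : nloops c = nloops c' -> perm_eq c c' -> W c = W c'.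
Proof.
move=> lc pc; rewrite /loop_weight lc (perm_size pc).
by move/seq.permP: pc => pc; rewrite !pc.
Qed.

Variables (U b : {set {set V}}) (e : {set V}) (n : nat).
Hypothesis U2 : forall e, e \in U -> #|e| = 2%N.
Hypothesis bU : b \subset U.
Hypothesis e2 : #|e| = 2%N.

Definition nfree c := count (fun p => free_slot b e (take p c)) (iota 0 (size c).+1).

(** The weight of a configuration with a uniform slot: the slots of [c] together carry the weight of
    [c]. *)
Let SS P := \sum_(s <- splits n | outcome U U b (s.1 ++ s.2) && P s)
  W (s.1 ++ s.2) / (size (s.1 ++ s.2)).+1%:R.

Let SSE (P : pred (config V)) : SS (fun s => P s.1) =
  \sum_(c <- configs_lt V n | outcome U U b c)
    W c * ((count (fun p => P (take p c)) (iota 0 (size c).+1))%:R / (size c).+1%:R).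
Proof.
rewrite /SS big_mkcond big_allpairs_dep [RHS]big_mkcond; apply: eq_bigr => c _ /=.
under eq_bigr do rewrite cat_take_drop.
case: (outcome U U b c) => /=; last by rewrite big1.
rewrite -[LHS](big_mkcond (fun p => P (take p c)) (fun=> W c / (size c).+1%:R)).
by rewrite big_const_seq iter_addr_0 -[LHS]mulr_natl mulrCA.
Qed.

Let wt0 (s : config V * config V) : 0 <= W (s.1 ++ s.2) / (size (s.1 ++ s.2)).+1%:R.
Proof. by rewrite divr_ge0. Qed.

Let SS_sub (P Q : pred (config V * config V)) : (forall s, P s -> Q s) -> SS P <= SS Q.
Proof.
move=> PQ; rewrite /SS [leLHS]big_mkcond [leRHS]big_mkcond /=; apply: ler_sum => s _.
case: (outcome _ _ _ _) => //=; case: (boolP (P s)) => [/PQ -> //|_].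
by case: ifP => _; rewrite ?wt0.
Qed.

Let SS_or (P Q : pred (config V * config V)) : SS (fun s => P s || Q s) <= SS P + SS Q.
Proof.
rewrite /SS [leLHS]big_mkcond [X in _ <= X + _]big_mkcond [X in _ <= _ + X]big_mkcond.
rewrite -big_split /=; apply: ler_sum => s _; have := wt0 s.
case: (outcome _ _ _ _) => /=; last by rewrite addr0.
by case: (P s); case: (Q s) => /= ws; rewrite ?addr0 ?add0r // lerDl.
Qed.

Let cov v k (s : config V * config V) := covered b v s.1 && (pending b e s.2 <= k)%N.

Let SS_advance v k : v \in e ->
  SS (cov v k.+1) <= SS (fun s => ~~ covered b v s.1 && (pending b e s.2 <= k)%N).
Proof.
move=> ve; apply: (@ler_sum_inj _ _ _ _ _ _ _ _ _ (@advance V v)).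
- exact: splits_uniq.
- exact: splits_uniq.
- move=> [a z] /= azn /andP[oc /andP[cv pk]].
  have [[oc' nc pp ss] [nl pe]] := covered_advance U2 bU oc cv ve.
  split; last by rewrite (loop_weight_perm nl pe) ss.
    by case E: (advance v (a, z)) ss => [a' z'] /= ss; rewrite mem_splits ss -mem_splits.
  by rewrite oc' nc /= -ltnS (leq_trans pp).
- move=> [a z] [a' z'] _ /andP[oc /andP[cv _]] _ /andP[oc' /andP[cv' _]].
  by move=> E; exact: (advance_inj U2 bU oc cv oc' cv' E).
- by move=> s _; exact: wt0.
Qed.

(** An exchange at [v] uncovers [v] and lowers [pending]. The new slot is free or covered at the
    other endpoint [w], where the induction goes on with [v] and [w] interchanged; each round adds
    one copy of the free weight. *)
Let SS_cov k : forall v w, e = [set v; w] ->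
  SS (cov v k) <= k%:R * SS (fun s => free_slot b e s.1).
Proof.
elim: k => [|k IH] v w evw.
  rewrite mul0r /SS big1 // => -[a z] /andP[oc /andP[cv pk]].
  have ve : v \in e by rewrite evw !inE eqxx.
  have [[_ _ pp _] _] := covered_advance U2 bU oc cv ve.
  by move: (leq_trans pp pk); rewrite ltn0.
have ve : v \in e by rewrite evw !inE eqxx.
apply: le_trans (SS_advance k ve) _; rewrite -natr1 mulrDl mul1r.
apply: (@le_trans _ _ (SS (fun s => cov w k s || free_slot b e s.1))).
  apply: SS_sub => s /andP[nc pk]; rewrite evw free_slotE (negPf nc) /= /cov pk andbT.
  by rewrite orbN.
apply: le_trans (SS_or _ _) _; rewrite lerD2r; apply: (IH w v).
by rewrite finset.setUC.
Qed.

(** A slot is free or covered at one of the two endpoints, and each covered case costs at most [D]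
    times the free weight. With D = 2K-2 the constant is 4K-3. *)
Lemma free_slots_sum D : (#|[set g in b | g :&: e != finset.set0]| <= D)%N ->
  \sum_(c <- configs_lt V n | outcome U U b c) W c <=
  (2 * D + 1)%:R * \sum_(c <- configs_lt V n | outcome U U b c)
    W c * ((nfree c)%:R / (size c).+1%:R).
Proof.
move=> hD; rewrite /nfree -SSE.
have /eqP/cards2P[v [w [vw evw]]] := e2.
have pD s : (pending b e s <= D)%N.
  apply: leq_trans hD; apply: subset_leq_card; apply/fintype.subsetP => g.
  by rewrite !inE => /and3P[-> ->].
have -> : \sum_(c <- configs_lt V n | outcome U U b c) W c = SS (fun s => xpredT s.1).
  rewrite (SSE xpredT); apply: eq_bigr => c _.
  by rewrite count_predT size_iota divff ?mulr1 // pnatr_eq0.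
apply: (@le_trans _ _ (SS (fun s => (cov v D s || cov w D s) || free_slot b e s.1))).
  by apply: SS_sub => s _; rewrite evw free_slotE /cov !pD !andbT orbN.
apply: le_trans (SS_or _ _) _.
apply: le_trans (lerD (SS_or _ _) (lexx _)) _.
have h1 := SS_cov D evw; have h2 : SS (cov w D) <= D%:R * SS (fun s => free_slot b e s.1).
  by apply: (SS_cov D (w := v)); rewrite finset.setUC.
apply: le_trans (lerD (lerD h1 h2) (lexx _)) _.
rewrite natrD natrM le_eqVlt; apply/orP; left; apply/eqP.
by move: (SS _) D%:R => X d; ring.
Qed.

End SwapSums.

(** * Pairs of slots with equal labels *)

Section PairCount.
Variables (R : realFieldType) (N M : nat) (F : pred nat) (L : nat -> nat).
Hypothesis LM : forall p, (p < N)%N -> (L p < M)%N.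

Let r := iota 0 N.
Let s : R := (count F r)%:R.

(* Cauchy-Schwarz over the label classes, in the linear form s_j^2 >= 2 x s_j - x^2. *)
Lemma same_label_pairs (x : R) :
  2 * x * s - x ^+ 2 * M%:R <=
  \sum_(p <- r | F p) \sum_(q <- r | F q) (L p == L q)%:R.
Proof.
pose sj j : R := \sum_(p <- r | F p) (L p == j)%:R.
have sE : s = \sum_(0 <= j < M) sj j.
  rewrite /sj exchange_big /s -sum1_count natr_sum big_seq_cond [RHS]big_seq_cond.
  apply: eq_bigr => p /andP[]; rewrite mem_iota => /= /LM pM _.
  rewrite (bigD1_seq (L p)) ?iota_uniq ?mem_index_iota //= eqxx big1 ?addr0 //.
  by move=> j /negPf; rewrite eq_sym => ->.
have -> : \sum_(p <- r | F p) \sum_(q <- r | F q) (L p == L q)%:R =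
    \sum_(0 <= j < M) sj j ^+ 2.
  under [RHS]eq_bigr do rewrite expr2 mulr_suml.
  rewrite [RHS]exchange_big [LHS]big_seq_cond [RHS]big_seq_cond; apply: eq_bigr => p /andP[].
  rewrite mem_iota => /= /LM pM _.
  rewrite (bigD1_seq (L p)) ?iota_uniq ?mem_index_iota //= eqxx mul1r [X in _ + X]big1 ?addr0.
    by rewrite /sj; apply: eq_bigr => q _; rewrite eq_sym.
  by move=> j /negPf; rewrite eq_sym => ->; rewrite mul0r.
have -> : x ^+ 2 * M%:R = \sum_(0 <= j < M) x ^+ 2.
  by rewrite big_const_nat subn0 iter_addr_0 mulr_natr.
rewrite sE mulr_sumr -sumrB; apply: ler_sum => j _.
by have := sqr_ge0 (sj j - x); move: (sj j) => t; nra.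
Qed.

(** By symmetry the pairs off the diagonal are counted equally on both sides, while the diagonal is
    counted once more on the left. This extra [s] later turns N^2 into N(N+1). *)
Lemma same_label_pairs_le :
  2 * \sum_(p <- r | F p) \sum_(q <- r | F q) ((L p == L q) && (p <= q)%N)%:R =
  \sum_(p <- r | F p) \sum_(q <- r | F q) (L p == L q)%:R + s :> R.
Proof.
pose A p q : R := ((L p == L q) && (p <= q)%N)%:R.
have -> : 2 * \sum_(p <- r | F p) \sum_(q <- r | F q) A p q =
    \sum_(p <- r | F p) \sum_(q <- r | F q) A p q +
    \sum_(p <- r | F p) \sum_(q <- r | F q) A q p.
  by rewrite [X in _ = _ + X]exchange_big mulr_natl mulr2n.
have -> : s = \sum_(p <- r | F p) \sum_(q <- r | F q) (p == q)%:R.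
  rewrite /s -sum1_count natr_sum big_seq_cond [RHS]big_seq_cond.
  apply: eq_bigr => p /andP[pr Fp]; rewrite big_mkcond (bigD1_seq p) ?iota_uniq //=.
  by rewrite Fp eqxx big1 ?addr0 // => q /negPf; rewrite eq_sym => ->; case: ifP.
rewrite -!big_split; apply: eq_bigr => p _; rewrite -!big_split; apply: eq_bigr => q _ /=.
rewrite /A; case: (ltngtP p q) => [pq|pq|->]; rewrite ?andbT ?andbF ?eqxx //= ?addr0 //.
by rewrite eq_sym add0r.
Qed.

End PairCount.

(** * Inserting a blocking pair *)

Section PairInsertion.
Variable V : finType.
Implicit Types (a c z : config V) (e f g h : {set V}) (U b : {set {set V}}) (n : nat).

Lemma first_hit_inj (T : eqType) (P : pred T) (a a' z z' : seq T) (x x' : T) :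
  all (predC P) a -> all (predC P) a' -> P x -> P x' ->
  a ++ x :: z = a' ++ x' :: z' -> [/\ a = a', x = x' & z = z'].
Proof.
elim: a a' => [|y a IH] [|y' a'] /=; first by move=> _ _ _ _ [-> ->].
- by move=> _ /andP[+ _] Px _ [xy _]; rewrite -xy Px.
- by move=> /andP[+ _] _ _ Px' [xy _]; rewrite xy Px'.
by move=> /andP[_ aP] /andP[_ aP'] Px Px' [-> /(IH _ aP aP' Px Px')[-> -> ->]].
Qed.

Definition twice e a m z : config V := a ++ (e, true) :: m ++ (e, true) :: z.

(** With no other link on [e], the two inserted crosses can be located again. *)
Lemma twice_inj e a m z a' m' z' :
  Nlinks a e = 0%N -> Nlinks m e = 0%N -> Nlinks a' e = 0%N -> Nlinks m' e = 0%N ->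
  twice e a m z = twice e a' m' z' -> [/\ a = a', m = m' & z = z'].
Proof.
have no (c : config V) : Nlinks c e = 0%N -> all (predC (fun l : link V => l.1 == e)) c.
  by move=> c0; rewrite all_predC has_count [count _ _]c0.
move=> /no a0 /no m0 /no a0' /no m0'; rewrite /twice.
have hit := @first_hit_inj _ (fun l : link V => l.1 == e).
case/(hit _ _ _ _ (e, true) (e, true) a0 a0' (eqxx e) (eqxx e)) => -> _.
by case/(hit _ _ _ _ (e, true) (e, true) m0 m0' (eqxx e) (eqxx e)) => -> _ ->.
Qed.

Lemma unbarred_empty (g : {set V}) n a : Nlinks a g = 0%N -> n != 1%N -> unbarred g n a.
Proof.
move=> a0 n1; apply/unbarredP => a1 l a2 ae lg; rewrite (_ : Nlinks a1 g = 0%N) ?addn0.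
  by move/eqP: n1.
by move: a0; rewrite ae Nlinks_cat => /eqP; rewrite addn_eq0 => /andP[/eqP].
Qed.

Section Outcome.
Variables (U b : {set {set V}}) (e : {set V}).
Hypothesis U2 : forall g, g \in U -> #|g| = 2%N.
Hypothesis bU : b \subset U.
Hypothesis e2 : #|e| = 2%N.
Hypothesis eU : e \notin U.

Lemma outcome_absent c : outcome U U b c -> Nlinks c e = 0%N.
Proof.
move=> /outcomeP[cU _ _]; apply/eqP; rewrite -leqn0 leqNgt -has_count.
by apply/hasPn => l /cU lU; apply: contraNneq eU => <-.
Qed.

(** An edge meeting [e] has no link in [m], so it has met equally many of its links at both slots.
    Freeness of the first slot therefore protects it from both crosses. *)
Lemma outcome_twice a m z : outcome U U b (a ++ m ++ z) -> free_slot b e a ->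
  all (fun l : link V => ~~ touch l e) m ->
  outcome (e |: U) (e |: U) (e |: b) (twice e a m z).
Proof.
move=> oc fa me; have /outcomeP[cU cN cH] := oc; have := outcome_absent oc.
rewrite !Nlinks_cat => /eqP; rewrite !addn_eq0 => /and3P[/eqP a0 /eqP m0 /eqP z0].
have NE g : g != e -> Nlinks (twice e a m z) g = Nlinks (a ++ m ++ z) g.
  by move=> ge; rewrite /twice !(Nlinks_cat, Nlinks_cons) /= eq_sym (negPf ge).
have Ne : Nlinks (twice e a m z) e = 2%N.
  by rewrite /twice !(Nlinks_cat, Nlinks_cons) /= eqxx a0 m0 z0.
apply/outcomeP; split.
- move=> l; rewrite /twice !(mem_cat, inE) => h; apply/orP.
  have [lc|] := boolP (l \in a ++ m ++ z); first by right; exact: cU.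
  rewrite !mem_cat !negb_or => /and3P[la lm lz]; left.
  by move: h; rewrite (negPf la) (negPf lm) (negPf lz) orbF /= orbb => /eqP ->.
- move=> g; have [->|ge] := eqVneq g e; first by rewrite Ne.
  by rewrite !inE (negPf ge) /= NE //; exact: cN.
move=> h; have [-> _|he] := eqVneq h e.
  rewrite !inE eqxx blockingE Ne eqxx /=; apply/andP; split.
    have nox (c : config V) : Nlinks c e = 0%N -> all (fun l : link V => (l.1 == e) ==> l.2) c.
      move=> c0; apply/allP => l lc; apply/implyP => le.
      have : (0 < Nlinks c e)%N by rewrite -has_count; apply/hasP; exists l.
      by rewrite c0.
    by rewrite /twice !all_cat /= !all_cat /= !nox // eqxx.
  rewrite /twice unbarred_cat unbarred_empty // a0 /= eqxx unbarred_cat m0 /= eqxx addn0.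
  rewrite (unbarred_empty z0) // andbT; apply/unbarredP => m1 l m2 mE _ _.
  by move: me; rewrite mE all_cat /= => /and3P[].
rewrite !inE (negPf he) /= => hU; rewrite -(cH h hU).
have eh : (e, true).1 != h by rewrite eq_sym.
rewrite /twice blocking_insert // !catA blocking_insert // -catA.
case: (boolP (blocking _ h)) => //= bh; have hb : h \in b by rewrite -(cH h hU).
rewrite -!negb_or; apply/negP.
have : ~~ ((Nlinks a h == 1%N) && touch (e, true) h).
  apply: contra fa => /andP[ah th]; apply/exists_inP; exists h => //.
  by rewrite ah andbT finset.setIC.
case: (boolP (touch _ h)) => [th|]; last by rewrite !andbF.
rewrite Nlinks_cat (_ : Nlinks m h = 0%N) ?addn0 => [/negPf ->//|].
apply/eqP; rewrite -leqn0 leqNgt; apply/negP => /Nlinks_first[m1 [l [m2 [mE lh _]]]].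
by move: me; rewrite mE all_cat /= /touch lh finset.setIC [_ :&: _ != _]th andbF.
Qed.

Variable R : realType.
Variables beta u theta : R.
Hypotheses (hbeta : 0 < beta) (htheta : 0 < theta) (hu0 : 0 < u) (hu1 : u <= 1).

Local Notation W := (loop_weight beta u theta).
Let W0 (c : config V) : 0 <= W c := loop_weight_ge0 hbeta htheta hu0 hu1 c.

Lemma loop_weight_twice a m z : all (fun l : link V => ~~ touch l e) m ->
  W (twice e a m z) = W (a ++ m ++ z) *
    (beta ^+ 2 * u ^+ 2 / ((size (a ++ m ++ z)).+1%:R * (size (a ++ m ++ z)).+2%:R)).
Proof.
move=> me; rewrite /loop_weight /twice nloops_pair //; last first.
  by apply: sub_all me => l; rewrite negbK.
set c := a ++ m ++ z; set c' := a ++ _.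
have cE (p : pred (link V)) : count p c' = ((p (e, true)).*2 + count p c)%N.
  rewrite /c' /c !count_cat /= !count_cat /= -addnn; lia.
have -> : size c' = (size c).+2 by rewrite /c' /c !size_cat /= !size_cat /= !addnS.
rewrite !cE /= !factS !natrM add2n add0n !exprS expr0 !mulr1.
have := ler0n R (size c)`!; have f0 : (size c)`!%:R != 0 :> R by rewrite pnatr_eq0 -lt0n fact_gt0.
have n1 : (size c).+1%:R != 0 :> R by rewrite pnatr_eq0.
have n2 : (size c).+2%:R != 0 :> R by rewrite pnatr_eq0.
clear -f0 n1 n2; move: (size c)`!%:R (size c).+1%:R (size c).+2%:R f0 n1 n2.
move: (beta ^+ _) (u ^+ _) ((1 - u) ^+ _) (theta ^+ _) => p q s t x y w x0 y0 w0 _.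
by field; rewrite x0 y0 w0.
Qed.

Definition ntouch c := count (fun l : link V => touch l e) c.

(** Equal values of [ntouch] say that no link between the two slots touches [e]; this turns
    admissible pairs into pairs with equal labels. *)
Let good c (p q : nat) := [&& free_slot b e (take p c), free_slot b e (take q c),
  ntouch (take p c) == ntouch (take q c) & (p <= q)%N].

Let pairs_sum n :
  \sum_(c <- configs_lt V n | outcome U U b c) \sum_(p <- iota 0 (size c).+1)
    \sum_(q <- iota 0 (size c).+1) (good c p q)%:R *
      (W c * (beta ^+ 2 * u ^+ 2 / ((size c).+1%:R * (size c).+2%:R))) <=
  \sum_(c <- configs_lt V n.+2 | outcome (e |: U) (e |: U) (e |: b) c) W c.
Proof.
pose js c := [seq (p, q) | p <- iota 0 (size c).+1, q <- iota 0 (size c).+1].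
pose ts := [seq (c, j) | c <- configs_lt V n, j <- js c].
have -> : \sum_(c <- configs_lt V n | outcome U U b c) \sum_(p <- iota 0 (size c).+1)
    \sum_(q <- iota 0 (size c).+1) (good c p q)%:R *
      (W c * (beta ^+ 2 * u ^+ 2 / ((size c).+1%:R * (size c).+2%:R))) =
  \sum_(t <- ts | outcome U U b t.1 && good t.1 t.2.1 t.2.2)
    W t.1 * (beta ^+ 2 * u ^+ 2 / ((size t.1).+1%:R * (size t.1).+2%:R)).
  rewrite [RHS]big_mkcond [RHS]big_allpairs_dep [LHS]big_mkcond; apply: eq_bigr => c _ /=.
  case: (outcome U U b c) => /=; last by rewrite big1.
  rewrite [RHS]big_allpairs_dep; apply: eq_bigr => p _; apply: eq_bigr => q _ /=.
  by case: (good c p q); rewrite ?mul1r ?mul0r.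
have memts c p q : (c, (p, q)) \in ts -> [/\ (size c < n)%N, (p <= size c)%N & (q <= size c)%N].
  move=> /allpairsPdep[c' [j [cn + [cc jE]]]]; rewrite -jE -cc in cn *.
  by move=> /allpairsPdep[p' [q' [+ + [-> ->]]]]; rewrite !mem_iota !ltnS -mem_configs_lt.
have split3 c p q : (p <= q <= size c)%N -> good c p q ->
    c = take p c ++ take (q - p) (drop p c) ++ drop q c /\
    all (fun l : link V => ~~ touch l e) (take (q - p) (drop p c)).
  move=> /andP[pq qc] /and4P[_ _ /eqP Lpq _].
  have tq : take q c = take p c ++ take (q - p) (drop p c).
    by rewrite -takeD subnKC.
  split; first by rewrite catA -tq cat_take_drop.
  move: Lpq; rewrite tq /ntouch count_cat => /eqP; rewrite -{1}[count _ _]addn0 eqn_add2l eq_sym.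
  by rewrite -leqn0 leqNgt -has_count -all_predC.
apply: (@ler_sum_inj _ _ _ _ _ _ _ _ _ (fun t : config V * (nat * nat) =>
   twice e (take t.2.1 t.1) (take (t.2.2 - t.2.1) (drop t.2.1 t.1)) (drop t.2.2 t.1))).
- apply: allpairs_uniq_dep => [|c _|]; rewrite ?configs_lt_uniq //; last by move=> [c i] [c' i'] _ _ [-> ->].
  by apply: allpairs_uniq; rewrite ?iota_uniq // => -[i j] [i' j'] _ _ [-> ->].
- exact: configs_lt_uniq.
- move=> [c [p q]] /memts[cn pc qc] /= /andP[oc gd]; have /and4P[fp fq _ pq] := gd.
  have [cE mU] : _ /\ _ := split3 c p q (introT andP (conj pq qc)) gd.
  split.
  + rewrite mem_configs_lt /twice size_cat /= size_cat /= !addnS !ltnS.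
    by rewrite -!size_cat -cE.
  + by apply: outcome_twice => //; rewrite -cE.
  + by rewrite loop_weight_twice // -cE.
- move=> [c [p q]] [c' [p' q']] /memts[_ pc qc] /= /andP[oc gd] /memts[_ pc' qc'] /andP[oc' gd'].
  have /and4P[_ _ _ pq] := gd; have /and4P[_ _ _ pq'] := gd'.
  have [cE mU] := split3 c p q (introT andP (conj pq qc)) gd.
  have [cE' mU'] := split3 c' p' q' (introT andP (conj pq' qc')) gd'.
  have := outcome_absent oc; have := outcome_absent oc'.
  rewrite {1}cE {1}cE' !Nlinks_cat => /eqP + /eqP.
  rewrite !addn_eq0 => /and3P[/eqP a0' /eqP m0' _] /and3P[/eqP a0 /eqP m0 _].
  move=> /(twice_inj a0 m0 a0' m0')[aE mE zE].
  have cc : c = c' by rewrite cE cE' aE mE zE.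
  have pp : p = p' by have := congr1 size aE; rewrite !size_takel.
  have := congr1 size zE; rewrite !size_drop -cc => qq; congr (_, (_, _)) => //.
  by rewrite -cc in qc'; lia.
- by move=> c _; exact: W0.
Qed.

(** The bound is linear in the share of free slots and in the number of touching links, so only
    their means are needed; [k] is optimised afterwards. *)
Lemma insertion_sum n (k : R) :
  (beta ^+ 2 * u ^+ 2 / 2) * \sum_(c <- configs_lt V n | outcome U U b c)
     W c * (2 * k * ((nfree b e c)%:R / (size c).+1%:R) - k ^+ 2 * (ntouch c).+1%:R) <=
  \sum_(c <- configs_lt V n.+2 | outcome (e |: U) (e |: U) (e |: b) c) W c.
Proof.
apply: le_trans (pairs_sum n); rewrite mulr_sumr; apply: ler_sum => c _.
under eq_bigr do rewrite -mulr_suml; rewrite -mulr_suml.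
set N := (size c).+1; set M := (ntouch c).+1.
pose F p := free_slot b e (take p c); pose L p := ntouch (take p c).
have LM p : (p < N)%N -> (L p < M)%N.
  by move=> _; rewrite ltnS; apply: leq_count_subseq; exact: take_subseq.
(* With x = k N the bound becomes quadratic in the number N of slots, like the number of pairs. *)
have h1 := same_label_pairs F LM (k * N%:R); have h2 := same_label_pairs_le R N F L.
set G := \sum_(p <- _) _; have GE : G = \sum_(p <- iota 0 N | F p) \sum_(q <- iota 0 N | F q)
    ((L p == L q) && (p <= q)%N)%:R.
  rewrite /G [RHS]big_mkcond; apply: eq_bigr => p _; rewrite -/(F p).
  rewrite /good -/(F p); case: (F p); last by rewrite big1.
  by rewrite [RHS]big_mkcond; apply: eq_bigr => q _; rewrite -/(F q); case: (F q).
rewrite -GE in h2; rewrite -/(nfree b e c) in h1 h2.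
have sN : (nfree b e c <= N)%N by rewrite /nfree (leq_trans (count_size _ _)) // size_iota.
have N0 : 0 < N%:R :> R by rewrite ltr0n.
have sN' : (nfree b e c)%:R <= N%:R :> R by rewrite ler_nat.
have M1 : 1 <= M%:R :> R by rewrite ler1n.
have s0 : 0 <= (nfree b e c)%:R :> R by [].
have -> : N.+1%:R = N%:R + 1 :> R by rewrite -natr1.
move: h1 h2; set S := \sum_(_ <- _ | _) _; move: S G {GE} => S G.
move: (nfree b e c)%:R N%:R M%:R s0 M1 N0 sN' => s x m s0 m1 x0 sx h1 h2.
have WW := W0 c; move: (W c) WW => w w0.
have x2 : x != 0 by rewrite lt0r_neq0.
have [l [l0 l1 sE]] : exists l, [/\ 0 <= l, l <= 1 & s = l * x].
  exists (s / x); rewrite mulfVK //; split => //; first by rewrite divr_ge0 // ltW.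
  by rewrite ler_pdivrMr // mul1r.
subst s; rewrite mulfK //.
set Y := 2 * k * l - k ^+ 2 * m.
(* The diagonal pairs contribute l x; as Y <= l, this covers the difference between x^2 Y and x (x +
   1) Y. *)
have Yl : Y <= l.
  rewrite -subr_ge0 (_ : _ - _ = (k - l) ^+ 2 + l * (1 - l) + k ^+ 2 * (m - 1));
    last by rewrite /Y; ring.
  apply: addr_ge0; first apply: addr_ge0; first exact: sqr_ge0.
    by apply: mulr_ge0; rewrite ?subr_ge0.
  by apply: mulr_ge0; [exact: sqr_ge0 | rewrite subr_ge0].
have GY : x * (x + 1) * Y <= 2 * G.
  rewrite h2; apply: (@le_trans _ _ (x ^+ 2 * Y + l * x)).
    rewrite -subr_ge0 (_ : _ - _ = x * (l - Y)); last by ring.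
    by rewrite mulr_ge0 ?subr_ge0 // ltW.
  rewrite lerD2r; apply: le_trans h1.
  by rewrite le_eqVlt; apply/orP; left; apply/eqP; rewrite /Y; ring.
have c0 : 0 <= w * (beta ^+ 2 * u ^+ 2 / (x * (x + 1))).
  by rewrite mulr_ge0 // divr_ge0 ?mulr_ge0 ?sqr_ge0 // ltW // addr_gt0.
have := ler_wpM2l c0 GY.
have x1 : x + 1 != 0 by rewrite lt0r_neq0 // addr_gt0.
have -> : w * (beta ^+ 2 * u ^+ 2 / (x * (x + 1))) * (x * (x + 1) * Y) = w * (beta ^+ 2 * u ^+ 2) * Y.
  by move: Y {Yl GY} => Y; field; rewrite x1 x2.
move: Y {Yl GY} (beta ^+ 2 * u ^+ 2 / (x * (x + 1))) {c0} (beta ^+ 2 * u ^+ 2) => Y d bu.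
move=> h; rewrite -(ler_pM2l (ltr0Sn R 1)); apply: le_trans (le_trans h _); lra.
Qed.

End Outcome.
End PairInsertion.

(** * The constant *)

(** Here K = k+1. The factor 4k+1 = 4K-3 stems from the free slots and 1 + 2k(2k+5) from the links
    touching [e]; the right side is K^2 times the constant 3 * 4^(K+1) of [delta_const]. *)
Lemma degree_pow_bound (k : nat) :
  ((1 + 2 * k * (2 * k + 5)) * (4 * k + 1) ^ 2 <= k.+1 ^ 2 * (3 * 4 ^ k.+2))%N.
Proof.
have h1 : (1 + 2 * k * (2 * k + 5) <= 5 * k.+1 ^ 2)%N by nia.
have h2 : (5 * (4 * k + 1) ^ 2 <= 3 * 4 ^ k.+2)%N.
  (* The square grows by a factor of at most four only from k = 1 on; k = 0 and k = 1 are
     computed. *)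
  elim: k {h1} => [//|[//|k] IH]; rewrite expnS.
  apply: (@leq_trans (4 * (5 * (4 * k.+1 + 1) ^ 2))); first by nia.
  by rewrite (mulnCA 3) leq_mul2l IH orbT.
by nia.
Qed.

Section Numerics.
Variable R : realType.

Lemma expR_sub1_ge (y : R) : 0 < y -> y * (1 + y / 2 + y ^+ 2 / 6) <= expR y - 1.
Proof.
move=> y0; have := sum_exp_coeff_le 4 (ltW y0).
rewrite !big_nat_recr //= big_geq // !factS fact0 => h.
rewrite lerBrDr; apply: le_trans h; rewrite le_eqVlt; apply/orP; left; apply/eqP.
by field.
Qed.

(** The decay of y/(e^y - 1) beats both the factor 1 + y/2 and the linear growth of p + q y, as if y
    were at most 2. *)
Lemma tilted_ratio (y p q : R) (m : nat) : 0 < y -> 0 <= q -> q <= p -> m != 1%N ->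
  (m = 0%N -> q = 0) ->
  (y / (expR y - 1) * (1 + y / 2)) ^+ m * (p + q * y) <= p + 2 * q.
Proof.
move=> y0 q0 qp m1 mq; have X1 := expR_sub1_ge y0.
set X := expR y - 1 in X1 *; set r := y / X * (1 + y / 2).
have p0 : 0 <= p by exact: le_trans qp.
have X0 : 0 < X by apply: lt_le_trans X1; rewrite mulr_gt0 // !addr_gt0 // ?divr_gt0 ?exprn_gt0.
case: m m1 mq => [_ /(_ erefl) ->|[//|m] _ _]; first by rewrite expr0 mul0r mulr0 mul1r.
(* Chosen so that (1 + y/2)(1 + z) is exactly 1 + y/2 + y^2/6, the lower bound for (e^y - 1)/y. *)
pose z := y ^+ 2 / (6 + 3 * y).
have d0 : 0 < 6 + 3 * y by rewrite addr_gt0 // mulr_gt0.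
have z0 : 0 <= z by rewrite divr_ge0 ?exprn_ge0 // ltW.
have r0 : 0 <= r.
  by apply: mulr_ge0; [exact: divr_ge0 (ltW y0) (ltW X0) | lra].
have rz : r * (1 + z) <= 1.
  have -> : r * (1 + z) = y * (1 + y / 2 + y ^+ 2 / 6) / X.
    by rewrite /r /z; field; rewrite !lt0r_neq0.
  by rewrite ler_pdivrMr // mul1r.
have r1 : r <= 1 by apply: le_trans rz; rewrite ler_peMr // lerDl.
have yz : y <= 3 * z + 2.
  have zE : z * (6 + 3 * y) = y ^+ 2 by rewrite mulfVK // lt0r_neq0.
  rewrite -(ler_pM2r d0) -subr_ge0.
  rewrite (_ : _ - _ = 3 * (z * (6 + 3 * y)) - 3 * y ^+ 2 + 12); last by ring.
  by rewrite zE subrr add0r.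
have -> : r ^+ m.+2 = r ^+ m * r ^+ 2 by rewrite -exprD addn2.
have rm : r ^+ m * r ^+ 2 <= r ^+ 2 by rewrite ler_piMl ?exprn_ge0 ?exprn_ile1.
have pq : p + q * y <= (p + 2 * q) * (1 + z) ^+ 2.
  have := mulr_ge0 q0 z0; have := mulr_ge0 p0 z0.
  have := mulr_ge0 (mulr_ge0 q0 z0) z0; have := mulr_ge0 (mulr_ge0 p0 z0) z0.
  have := ler_wpM2l q0 yz; have := mulr_ge0 z0 (_ : 0 <= p - q).
  by rewrite subr_ge0 => /(_ qp); rewrite expr2; nra.
have rm0 : 0 <= r ^+ m * r ^+ 2 by apply: mulr_ge0; exact: exprn_ge0.
have pq0 : 0 <= p + q * y by apply: addr_ge0 => //; apply: mulr_ge0 => //; exact: ltW.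
apply: le_trans (ler_pM rm0 pq0 rm pq) _; rewrite mulrCA -exprMn.
have rz0 : 0 <= r * (1 + z) by apply: mulr_ge0 => //; exact: addr_ge0.
apply: ler_piMr; first by apply: addr_ge0 => //; exact: mulr_ge0.
exact: exprn_ile1.
Qed.

Variables (K : nat) (beta u theta : R).
Hypotheses (hK : (0 < K)%N) (hbeta : 0 < beta) (htheta : 0 < theta) (hu0 : 0 < u) (hu1 : u <= 1).

Local Notation th := (Num.max theta theta^-1).
Local Notation tc := (Num.min theta theta^-1).
Local Notation y := (beta * th).

Lemma min_inv_gt0 : 0 < tc.
Proof. by rewrite lt_min htheta invr_gt0. Qed.

Lemma min_max_inv : tc * th = 1.
Proof.
by rewrite /Order.min /Order.max; case: ifP => _; rewrite ?mulfV ?mulVf ?lt0r_neq0.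
Qed.

Let factor : R := y / (expR y - 1).

Let factor_bounds : 0 < y -> 0 < expR y - 1 /\ 0 <= factor <= 1.
Proof.
move=> y0; have X1 := expR_sub1_ge y0.
have yX : y <= expR y - 1.
  apply: le_trans X1; apply: ler_peMr; first exact: ltW.
  rewrite -addrA lerDl.
  by apply: addr_ge0; apply: divr_ge0 => //; [exact: ltW | exact: sqr_ge0].
have X0 := lt_le_trans y0 yX; split => //.
apply/andP; split; first by apply: divr_ge0; exact: ltW.
by rewrite /factor ler_pdivrMr // mul1r.
Qed.

Lemma delta_const_le :
  delta_const K beta u theta * ((expR y - 1) * (1 + y / 2) ^+ (2 * K - 2)) <=
  (beta ^+ 2 * u ^+ 2 / 2) /
    ((4 * K - 3)%:R ^+ 2 * (1 + (2 * K - 2)%:R * ((2 * K + 1)%:R + y))).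
Proof.
have y0 : 0 < y by exact: rate_gt0.
have [X0 /andP[f0 f1]] := factor_bounds y0.
have t0 := min_inv_gt0; have tt := min_max_inv; have t1 : tc <= 1.
  by rewrite -tt ler_peMr ?(ltW t0) //; exact: max_inv_ge1.
rewrite /delta_const -/factor; case: K hK => // k _.
have -> : (2 * k.+1 - 2 = 2 * k)%N by clear; lia.
have -> : (2 * k.+1 - 1 = (2 * k).+1)%N by clear; lia.
have -> : (4 * k.+1 - 3 = 4 * k + 1)%N by clear; lia.
have -> : (2 * k.+1 + 1 = 2 * k + 3)%N by clear; lia.
set r := factor * (1 + y / 2).
set q : R := (2 * k)%:R; pose p : R := 1 + q * (2 * k + 3)%:R.
set Eb := 1 + q * ((2 * k + 3)%:R + y).
have q0 : 0 <= q by rewrite ler0n.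
have EbE : Eb = p + q * y by rewrite /Eb /p; ring.
have rp : r ^+ (2 * k) * Eb <= p + 2 * q.
  rewrite EbE; apply: tilted_ratio => //.
  - by rewrite /p ler_wpDl // ler_peMr // ler1n; clear; lia.
  - by clear; lia.
  - by rewrite /q => ->.
have Eb0 : 0 < Eb by rewrite /Eb ltr_pwDl // mulr_ge0 // addr_ge0 ?ler0n // ltW.
have nat_bound : (p + 2 * q) * (4 * k + 1)%:R ^+ 2 <= k.+1%:R ^+ 2 * (3 * 4 ^+ k.+2) :> R.
  have := degree_pow_bound k; rewrite -(ler_nat R) => h; apply: le_trans (le_trans h _).
    rewrite natrM natrX ler_wpM2r ?exprn_ge0 ?ler0n //.
    have -> : p + 2 * q = (1 + 2 * k * (2 * k + 3) + 2 * (2 * k))%N%:R.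
      by rewrite /p /q !natrD !natrM; ring.
    by rewrite ler_nat; clear; lia.
  by rewrite natrM natrX natrM natrX.
set C : R := 3 * 4 ^+ k.+2; have C0 : 0 < C by rewrite mulr_gt0 // exprn_gt0.
set D : R := (4 * k + 1)%:R; have D0 : 0 < D by rewrite ltr0n addn1.
have K0 : 0 < k.+1%:R :> R by rewrite ltr0n.
set B := beta * tc ^+ 3; have B0 : 0 < B by rewrite mulr_gt0 // exprn_gt0.
(* [C] pays for the polynomial in K, and [B] supplies the second power of [beta]; the first one
   comes from [y]. *)
have QC : B / (B + C) * C <= B.
  rewrite mulrAC ler_pdivrMr; last by rewrite addr_gt0.
  by rewrite ler_wpM2l ?(ltW B0) // lerDr ltW.
rewrite ler_pdivlMr; last by rewrite mulr_gt0 // exprn_gt0.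
have -> : 2^-1 * (u * tc / k.+1%:R) ^+ 2 * (B / (B + C)) * factor ^+ (2 * k).+1 *
    ((expR y - 1) * (1 + y / 2) ^+ (2 * k)) * (D ^+ 2 * Eb) =
  (2^-1 * u ^+ 2 * tc ^+ 2 * y * (B / (B + C)) / k.+1%:R ^+ 2) * (D ^+ 2 * (r ^+ (2 * k) * Eb)).
  have fX : factor * (expR y - 1) = y by rewrite mulfVK // lt0r_neq0.
  have alg (v t k' Q f fp X g d w Y : R) : k' != 0 -> f * X = Y ->
      2^-1 * (v * t / k') ^+ 2 * Q * (f * fp) * (X * g) * (d * w) =
      (2^-1 * v ^+ 2 * t ^+ 2 * Y * Q / k' ^+ 2) * (d * (fp * g * w)).
    by move=> k0 <-; field.
  rewrite [r ^+ _]exprMn [factor ^+ _.+1]exprS.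
  by apply: alg; rewrite ?lt0r_neq0.
have Q0 : 0 <= B / (B + C) by rewrite divr_ge0 ?(ltW B0) // ltW // addr_gt0.
have y0' := ltW y0; have u0' := ltW hu0; have tc0' := ltW t0.
have b0 := ltW hbeta; have th0 : 0 <= th := le_trans ler01 (max_inv_ge1 htheta).
have A1 : 0 <= 2^-1 * u ^+ 2 * tc ^+ 2 * y.
  by apply: mulr_ge0 => //; apply: mulr_ge0; [apply: mulr_ge0|]; rewrite ?invr_ge0 ?sqr_ge0.
have A0 := mulr_ge0 A1 Q0.
have step : D ^+ 2 * (r ^+ (2 * k) * Eb) <= k.+1%:R ^+ 2 * C.
  by apply: le_trans nat_bound; rewrite mulrC ler_wpM2r ?sqr_ge0.
apply: le_trans (ler_wpM2l _ step) _; first by rewrite divr_ge0 ?sqr_ge0.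
have -> : 2^-1 * u ^+ 2 * tc ^+ 2 * y * (B / (B + C)) / k.+1%:R ^+ 2 * (k.+1%:R ^+ 2 * C) =
   (2^-1 * u ^+ 2 * tc ^+ 2 * y) * (B / (B + C) * C).
  move: (B / _) => Q; field; exact: lt0r_neq0.
apply: le_trans (ler_wpM2l A1 QC) _.
have -> : 2^-1 * u ^+ 2 * tc ^+ 2 * y * B = (beta ^+ 2 * u ^+ 2 / 2) * (tc ^+ 4 * (tc * th)).
  by rewrite /B; move: tc th => s t; field.
rewrite tt mulr1 ler_piMr ?exprn_ile1 //.
by rewrite !mulr_ge0 ?exprn_ge0 ?invr_ge0 // ltW.
Qed.

Lemma delta_const_bounds : 0 <= delta_const K beta u theta <= 1.
Proof.
have y0 : 0 < y by exact: rate_gt0.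
have [X0 /andP[f0 f1]] := factor_bounds y0.
have t0 := min_inv_gt0; have tt := min_max_inv; have t1 : tc <= 1.
  by rewrite -tt ler_peMr ?(ltW t0) //; exact: max_inv_ge1.
rewrite /delta_const -/factor.
set C : R := 3 * 4 ^+ K.+1; have C0 : 0 < C by rewrite mulr_gt0 // exprn_gt0.
set B := beta * tc ^+ 3; have B0 : 0 < B by rewrite mulr_gt0 // exprn_gt0.
have K1 : 1 <= K%:R :> R by rewrite ler1n.
have K0 : 0 < K%:R :> R by rewrite ltr0n.
have h0 : 0 <= 2^-1 :> R by rewrite invr_ge0 ler0n.
have h1 : 2^-1 <= 1 :> R by rewrite invf_le1 // ler1n.
have ut0 : 0 <= u * tc by apply: mulr_ge0; exact: ltW.
have i2 : 0 <= u * tc / K%:R <= 1.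
  rewrite divr_ge0 //= ler_pdivrMr // mul1r; apply: le_trans K1.
  by apply: mulr_ile1 => //; exact: ltW.
have i3 : 0 <= B / (B + C) <= 1.
  have BC := addr_gt0 B0 C0.
  rewrite divr_ge0 ?(ltW B0) ?(ltW BC) //= ler_pdivrMr // mul1r lerDl.
  exact: ltW.
move: (_ / _) (B / _) i2 i3 => x Q /andP[x0 x1] /andP[Q0 Q1].
have x2 : 0 <= x ^+ 2 by exact: exprn_ge0.
have f2 : 0 <= factor ^+ (2 * K - 1) by exact: exprn_ge0.
have hx := mulr_ge0 h0 x2; have hQ := mulr_ge0 hx Q0.
rewrite mulr_ge0 //= mulr_ile1 ?exprn_ile1 // mulr_ile1 // mulr_ile1 //.
exact: exprn_ile1.
Qed.

End Numerics.

(** * The one-edge inequality *)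

Section OneSite.
Variable V : finType.
Implicit Types (a c z : config V) (e f g h : {set V}) (U b : {set {set V}}) (n : nat).
Variables (E : {set {set V}}) (K : nat).
Hypothesis hE : forall e, e \in E -> #|e| = 2%N.
Hypothesis hdeg : forall v : V, (#|[set e in E | v \in e]| <= K)%N.

Lemma degree_gt0 e : e \in E -> (0 < K)%N.
Proof.
move=> eE; have /eqP/cards2P[v [w [_ ev]]] := hE eE.
apply: leq_trans (hdeg v); apply/card_gt0P; exists e.
by rewrite !inE eE ev !inE eqxx.
Qed.

Lemma card_adjacent e : e \in E ->
  (#|[set g in E :\ e | e :&: g != finset.set0]| <= 2 * K - 2)%N.
Proof.
move=> eE; have /eqP/cards2P[v [w [_ ev]]] := hE eE.
have deg x : x \in e -> (#|[set g in E | x \in g] :\ e| <= K - 1)%N.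
  move=> xe; have := hdeg x; rewrite (cardsD1 e) inE eE xe /=.
  by move=> h; rewrite leq_subRL //; apply: leq_trans h.
have ve : v \in e by rewrite ev !inE eqxx.
have we : w \in e by rewrite ev !inE eqxx orbT.
apply: (@leq_trans #|([set g in E | v \in g] :\ e) :|: ([set g in E | w \in g] :\ e)|).
  apply: subset_leq_card; apply/fintype.subsetP => g; rewrite !inE.
  case/andP => /andP[-> ->] /finset.set0Pn[x]; rewrite !inE ev !inE.
  by case/andP => /orP[] /eqP -> ->; rewrite ?orbT.
apply: leq_trans (leq_card_setU _ _) _.
apply: leq_trans (leq_add (deg v ve) (deg w we)) _.
by clear; lia.
Qed.

Variable R : realType.
Variables beta u theta : R.
Hypotheses (hbeta : 0 < beta) (htheta : 0 < theta) (hu0 : 0 < u) (hu1 : u <= 1).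

Local Notation W := (loop_weight beta u theta).
Local Notation y := (beta * Num.max theta theta^-1).
Local Notation SW n P := (\sum_(c <- configs_lt V n | P c) W c).
Let W0 (c : config V) : 0 <= W c := loop_weight_ge0 hbeta htheta hu0 hu1 c.
Let y0 : 0 < y := rate_gt0 hbeta htheta.

Variables (U b : {set {set V}}) (e : {set V}).
Hypotheses (UE : U \subset E) (bU : b \subset U) (eE : e \in E) (eU : e \notin U).

Let U2 g : g \in U -> #|g| = 2%N.
Proof. by move=> /(fintype.subsetP UE); exact: hE. Qed.

(** A blocking neighbour carries two links, any other one at most (2K-2) + 3 + y on average. *)
Lemma mean_ntouch n :
  \sum_(c <- configs_lt V n | outcome U U b c) W c * (ntouch e c).+1%:R <=
  (1 + (2 * K - 2)%:R * ((2 * K + 1)%:R + y)) * SW n (outcome U U b).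
Proof.
pose F := [set g in U | e :&: g != finset.set0].
have nt c : outcome U U b c -> ntouch e c = (\sum_(g in F) Nlinks c g)%N.
  move=> /outcomeP[cU _ _]; rewrite /ntouch /Nlinks -sum1_count.
  under [RHS]eq_bigr do rewrite -sum1_count big_mkcond.
  rewrite exchange_big big_mkcond /= big_seq [RHS]big_seq; apply: eq_bigr => l /cU lU.
  rewrite -big_mkcondr /=; case: (boolP (touch l e)) => tl.
    rewrite (big_pred1 l.1) // => g /=.
    rewrite inE; have [->|gl] := eqVneq g l.1; last by rewrite andbF.
    by rewrite lU finset.setIC andbT.
  symmetry; apply: big_pred0 => g; rewrite inE; apply/negP => /andP[/andP[_ eg] /eqP lg].
  by move: tl; rewrite /touch lg finset.setIC eg.
have FD : (#|F| <= 2 * K - 2)%N.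
  apply: leq_trans (card_adjacent eE); apply: subset_leq_card.
  apply/fintype.subsetP => g; rewrite !inE => /andP[gU ->]; rewrite (fintype.subsetP UE) // !andbT.
  by apply: contraNneq eU => <-.
have K0 := degree_gt0 eE.
have one g : g \in F -> \sum_(c <- configs_lt V n | outcome U U b c) W c * (Nlinks c g)%:R <=
    ((2 * K + 1)%:R + y) * SW n (outcome U U b).
  rewrite inE => /andP[gU _]; have [gb|gb] := boolP (g \in b).
    rewrite mulr_sumr; apply: ler_sum => c /outcomeP[_ _ cH].
    rewrite (blocking_Nlinks (_ : blocking c g)) ?cH // mulrC ler_wpM2r //.
    by rewrite -[leLHS]addr0 lerD ?(ltW y0) // ler_nat; move: K0; clear; lia.
  have -> : (2 * K + 1 = 2 * K - 2 + 3)%N by move: K0; clear; lia.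
  apply: mean_links => //; apply: leq_trans (card_adjacent (fintype.subsetP UE _ gU)).
  apply: subset_leq_card; apply/fintype.subsetP => h; rewrite !inE.
  by case/andP => /andP[-> /(fintype.subsetP UE) ->] ->.
under eq_bigr => c oc do rewrite (nt c oc) -natr1 addrC mulrDr mulr1 natr_sum mulr_sumr.
rewrite big_split /= mulrDl mul1r lerD2l exchange_big /=.
have S0 : 0 <= SW n (outcome U U b) by apply: sumr_ge0.
apply: le_trans (ler_sum _ one) _; rewrite sumr_const -[leLHS]mulr_natl -[leRHS]mulrA ler_wpM2r ?ler_nat //.
by rewrite mulr_ge0 // addr_ge0 // ltW.
Qed.

Lemma outcome_block_sum n :
  (beta ^+ 2 * u ^+ 2 / 2) /
    ((4 * K - 3)%:R ^+ 2 * (1 + (2 * K - 2)%:R * ((2 * K + 1)%:R + y))) *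
    SW n (outcome U U b) <= SW n.+2 (outcome (e |: U) (e |: U) (e |: b)).
Proof.
have e2 := hE eE; have K0 := degree_gt0 eE.
set Eb := 1 + _; set D : R := (4 * K - 3)%:R.
have D0 : 0 < D by rewrite ltr0n; move: K0; clear; lia.
have Eb0 : 0 < Eb by rewrite ltr_pwDl // mulr_ge0 // addr_ge0 ?ler0n // ltW.
(* This [k] maximises 2k/D - k^2 Eb, where 1/D bounds the mean share of free slots from below and Eb
   the mean of ntouch + 1 from above. The maximum is 1/(D^2 Eb). *)
apply: le_trans (insertion_sum bU e2 eU hbeta htheta hu0 hu1 n (D * Eb)^-1).
rewrite mulrAC -mulrA; apply: ler_wpM2l.
  by apply: divr_ge0 => //; apply: mulr_ge0; exact: sqr_ge0.
under [leRHS]eq_bigr do rewrite mulrBr [W _ * (2 * _ * _)]mulrCA [W _ * (_ ^+ 2 * _)]mulrCA.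
rewrite sumrB -!mulr_sumr.
set S := SW n _; set k := (D * Eb)^-1.
have k0 : 0 < k by rewrite invr_gt0 mulr_gt0.
have hm := mean_ntouch n; rewrite -/Eb -/S in hm.
have hf : S <= D * \sum_(c <- configs_lt V n | outcome U U b c) W c * ((nfree b e c)%:R / (size c).+1%:R).
  have -> : D = (2 * (2 * K - 2) + 1)%:R by rewrite /D; congr _%:R; move: K0; clear; lia.
  apply: free_slots_sum => //; apply: leq_trans (card_adjacent eE); apply: subset_leq_card.
  apply/fintype.subsetP => g; rewrite !inE finset.setIC => /andP[/(fintype.subsetP bU) gU ->].
  rewrite (fintype.subsetP UE) // !andbT; apply: contraNneq eU => <- //.
move: hf hm; set A := \sum_(_ <- _ | _) _ * (_ / _); set B := \sum_(_ <- _ | _) _.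
move: S A B => S A B hf hm.
have -> : S / (D ^+ 2 * Eb) = 2 * k * (S / D) - k ^+ 2 * (Eb * S).
  by rewrite /k; field; rewrite !lt0r_neq0.
apply: lerB; last by rewrite ler_wpM2l ?sqr_ge0.
by apply: ler_wpM2l; [apply: mulr_ge0 => //; exact: ltW | rewrite ler_pdivrMr // mulrC].
Qed.

(** The one-edge inequality. On the left the status of [e] is free; the bound [n.+2] on the right
    makes room for the inserted pair. *)
Lemma blocking_step n :
  delta_const K beta u theta * SW n (outcome (e |: U) U b) <=
  SW n.+2 (outcome (e |: U) (e |: U) (e |: b)).
Proof.
have K0 := degree_gt0 eE.
apply: le_trans (outcome_block_sum n).
have S0 : 0 <= SW n (outcome U U b) by apply: sumr_ge0.
apply: le_trans (ler_wpM2r S0 (delta_const_le K0 hbeta htheta hu0)).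
have /andP[d0 _] := delta_const_bounds K0 hbeta htheta hu0 hu1.
rewrite -[leRHS]mulrA; apply: ler_wpM2l => //; rewrite -[leRHS]mulrA.
have eU2 g : g \in e |: U -> #|g| = 2%N.
  by rewrite !inE => /orP[/eqP -> |]; [exact: hE | exact: U2].
have := erase_outcome hbeta htheta hu0 hu1 n b eU2 (setU11 e U).
rewrite (setU1K eU); set G := [set g in _ | _] => h.
apply: le_trans h _; have X0 : 0 <= expR y - 1.
  by rewrite subr_ge0 -[leLHS]expR0 ler_expR ltW.
apply: ler_wpM2l => //.
pose G' := [set g in U | (e :&: g != finset.set0) && (g \notin b)].
have -> : U :\: G = U :\: G'.
  apply/finset.setP => g; rewrite !inE; case: (boolP (g \in U)) => gU; rewrite ?andbF //.
  by rewrite orbT.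
have G'U : G' \subset U by apply/fintype.subsetP => g; rewrite inE => /andP[].
have G'b : [disjoint G' & b].
  by rewrite disjoint_subset; apply/fintype.subsetP => g; rewrite !inE => /and3P[].
apply: le_trans (edges_free hbeta htheta hu0 hu1 n U2 (subxx U) G'U G'b) _.
apply: ler_wpM2r => //; apply: ler_weXn2l.
  by rewrite lerDl divr_ge0 // ltW.
apply: leq_trans (card_adjacent eE); apply: subset_leq_card.
apply/fintype.subsetP => g; rewrite !inE => /and3P[gU -> _].
rewrite (fintype.subsetP UE) // !andbT; apply: contraNneq eU => <- //.
Qed.

End OneSite.

(** * Coupling with Bernoulli percolation *)

Section Coupling.
Variables (V : finType) (R : realType).
Implicit Types (U B C w : {set {set V}}) (e f : {set V}).

Lemma sum_subsets U e (F : {set {set V}} -> R) : e \in U ->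
  \sum_(B : {set {set V}} | B \subset U) F B =
  \sum_(C : {set {set V}} | C \subset U :\ e) (F C + F (e |: C)).
Proof.
move=> eU; rewrite (bigID (fun B : {set {set V}} => e \in B)) /= big_split addrC /=.
congr (_ + _); first by apply: eq_bigl => B; rewrite finset.subsetD1.
rewrite (reindex_onto (fun C => e |: C) (fun B => B :\ e)) /=.
  apply: eq_bigl => C; rewrite finset.setU11 andbT finset.subUset finset.sub1set eU /= finset.subsetD1.
  apply/andb_id2l => _; apply/eqP/idP => [<-|eC]; first by rewrite !inE eqxx.
  exact: finset.setU1K.
by move=> B /andP[_ eB]; exact: finset.setD1K.
Qed.

Lemma bernoulli_perc_in (p : R) U e w : e \in U -> e \in w ->
  bernoulli_perc p U w = p * bernoulli_perc p (U :\ e) (w :\ e).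
Proof.
move=> eU ew; rewrite /bernoulli_perc.
have -> : (w :\ e \subset U :\ e) = (w \subset U).
  by rewrite -[in RHS](finset.setD1K ew) finset.subUset finset.sub1set eU finset.subsetD1 !inE eqxx andbT.
case: ifP => _; last by rewrite mulr0.
by rewrite (cardsD1 e U) (cardsD1 e w) eU ew subSS add1n exprS mulrA.
Qed.

Lemma bernoulli_perc_out (p : R) U e w : e \in U -> e \notin w ->
  bernoulli_perc p U w = (1 - p) * bernoulli_perc p (U :\ e) w.
Proof.
move=> eU ew; rewrite /bernoulli_perc finset.subsetD1 ew andbT.
case: ifP => wU; last by rewrite mulr0.
have cw : (#|w| <= #|U :\ e|)%N by apply: subset_leq_card; rewrite finset.subsetD1 wU.
by rewrite (cardsD1 e U) eU add1n subSn // exprS mulrCA.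
Qed.

(** Induction on the number of edges: summing out the status of one edge [e] gives weights [m] on
    the subsets of [U :\ e]. Adding the hypothesis at [C] and at [e |: C] shows that [m] satisfies
    it again. *)
Lemma bernoulli_coupling (p : R) U (mu : {set {set V}} -> R) : 0 <= p <= 1 ->
  (forall B, B \subset U -> 0 <= mu B) ->
  (forall e C, e \in U -> C \subset U :\ e -> p * (mu C + mu (e |: C)) <= mu (e |: C)) ->
  exists G : {set {set V}} -> {set {set V}} -> R,
    [/\ forall B w, B \subset U -> 0 <= G B w,
        forall B, B \subset U -> \sum_(w : {set {set V}}) G B w = mu B,
        forall B w, B \subset U -> ~~ (w \subset B) -> G B w = 0
      & forall w, \sum_(B : {set {set V}} | B \subset U) G B w =
          bernoulli_perc p U w * \sum_(B : {set {set V}} | B \subset U) mu B].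
Proof.
move=> /andP[p0 p1]; move Uk : #|U| => k; elim: k U Uk mu => [|k IH] U Uk mu mu0 hmu.
  have U0 : U = finset.set0 by apply/eqP; rewrite -cards_eq0 Uk.
  have sub0 B : (B \subset U) = (B == finset.set0) by rewrite U0 finset.subset0.
  exists (fun B w => if w == finset.set0 then mu B else 0); split.
  - by move=> B w BU; case: ifP => // _; exact: mu0.
  - by move=> B _; rewrite -big_mkcond big_pred1_eq.
  - move=> B w; rewrite sub0 => /eqP ->; rewrite finset.subset0 => /negPf -> //.
  - move=> w; rewrite /bernoulli_perc !sub0 !(eq_bigl _ _ sub0) !big_pred1_eq U0.
    case: eqP => [->|_]; last by rewrite mul0r.
    by rewrite cards0 !expr0 !mul1r.
have /finset.set0Pn[e eU] : U != finset.set0 by rewrite -card_gt0 Uk.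
have Uk' : #|U :\ e| = k by move: Uk; rewrite (cardsD1 e) eU => -[].
have CU C : C \subset U :\ e -> C \subset U by rewrite finset.subsetD1 => /andP[].
have eCU C : C \subset U :\ e -> e |: C \subset U.
  by move=> /CU CU'; rewrite finset.subUset finset.sub1set eU.
pose m C := mu C + mu (e |: C).
have m0 C : C \subset U :\ e -> 0 <= m C.
  by move=> CU'; apply: addr_ge0; apply: mu0; [exact: CU | exact: eCU].
have mE C : C \subset U :\ e -> m C = mu C + mu (e |: C) by [].
have hm f C : f \in U :\ e -> C \subset (U :\ e) :\ f -> p * (m C + m (f |: C)) <= m (f |: C).
  rewrite !inE => /andP[fe fU] CUf.
  have C1 : C \subset U :\ f.
    by apply: fintype.subset_trans CUf _; apply: finset.setSD; exact: finset.subD1set.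
  have C2 : e |: C \subset U :\ f.
    by rewrite finset.subUset finset.sub1set C1 !inE eq_sym fe eU.
  have := lerD (hmu f C fU C1) (hmu f (e |: C) fU C2).
  rewrite (_ : f |: (e |: C) = e |: (f |: C)); last by rewrite !finset.setUA (finset.setUC [set f]).
  by rewrite -mulrDr addrACA.
have [G' [G'0 G'm G's G'b]] := IH _ Uk' m m0 hm.
pose joint B (w : {set {set V}}) :=
  if e \in B then (if e \in w then p * m (B :\ e) else mu B - p * m (B :\ e))
  else (if e \in w then 0 else mu B).
have BU B : B \subset U -> B :\ e \subset U :\ e by move=> BU; exact: finset.setSD.
have G'out C w : C \subset U :\ e -> e \in w -> G' C w = 0.
  move=> CU' ew; apply: G's => //; apply/negP => /fintype.subsetP/(_ e ew).
  by move/(fintype.subsetP CU'); rewrite !inE eqxx.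
(* Where [m C] vanishes, so does [G' C w]; the value 0 of a division by zero is then the right
   one. *)
have G'mm C w : C \subset U :\ e -> G' C w / m C * m C = G' C w.
  move=> CU'; have [mC|mC] := eqVneq (m C) 0; last by rewrite mulfVK.
  rewrite mC mulr0; have := G'm C CU'; rewrite mC => /eqP.
  rewrite psumr_eq0; last by move=> v _; exact: G'0.
  by move=> /allP/(_ w (mem_index_enum _))/eqP.
(* Given B minus e, the status of e is coupled independently of the rest. *)
exists (fun B w => G' (B :\ e) (w :\ e) / m (B :\ e) * joint B w); split.
- move=> B w BU'; have B' := BU B BU'; apply: mulr_ge0.
    by apply: divr_ge0; [exact: G'0 | exact: m0].
  rewrite /joint; case: (boolP (e \in B)) => eB; case: ifP => _ //; last exact: mu0.
    by apply: mulr_ge0 => //; exact: m0.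
  by rewrite subr_ge0; have := hmu e _ eU B'; rewrite -/(m (B :\ e)) finset.setD1K.
- move=> B BU'; have B' := BU B BU'.
  rewrite (eq_bigl (fun w : {set {set V}} => w \subset [set: {set V}])); last by move=> w; rewrite finset.subsetT.
  rewrite (sum_subsets (e := e)) ?inE //.
  have -> : \sum_(C : {set {set V}} | C \subset [set: {set V}] :\ e)
      (G' (B :\ e) (C :\ e) / m (B :\ e) * joint B C +
       G' (B :\ e) ((e |: C) :\ e) / m (B :\ e) * joint B (e |: C)) =
      \sum_(C : {set {set V}} | C \subset [set: {set V}] :\ e)
      G' (B :\ e) C / m (B :\ e) * mu B.
    apply: eq_bigr => C; rewrite finset.subsetD1 => /andP[_ eC].
    have -> : C :\ e = C by apply/finset.setDidPl; rewrite disjoint_sym finset.disjoints1.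
    rewrite finset.setU1K // -mulrDr /joint finset.setU11 (negPf eC).
    by case: ifP => _; rewrite ?subrK ?addr0.
  rewrite -!mulr_suml.
  have -> : \sum_(C : {set {set V}} | C \subset [set: {set V}] :\ e) G' (B :\ e) C = m (B :\ e).
    rewrite -(G'm _ B') [RHS](bigID (fun w : {set {set V}} => e \in w)) /= [X in _ = X + _]big1 ?add0r.
      by apply: eq_bigl => C; rewrite finset.subsetD1 finset.subsetT.
    by move=> w ew; exact: G'out.
  have [mB|mB] := eqVneq (m (B :\ e)) 0; last by rewrite divff // mul1r.
  rewrite mB mul0r mul0r; have : mu (B :\ e) + mu (e |: (B :\ e)) = 0 by [].
  move/eqP; rewrite (paddr_eq0 (mu0 _ (CU _ B')) (mu0 _ (eCU _ B'))) => /andP[/eqP z0 /eqP z1].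
  have [eB|eB] := boolP (e \in B); first by rewrite -{1}(finset.setD1K eB) z1.
  by rewrite -[B](_ : B :\ e = B) ?z0 //; apply/finset.setDidPl; rewrite disjoint_sym finset.disjoints1.
- move=> B w BU' wB; have B' := BU B BU'.
  have [eB|eB] := boolP (e \in B); last first.
    rewrite /joint (negPf eB); case: ifP => ew; first by rewrite mulr0.
    rewrite G's ?mul0r //; apply: contra wB => wB.
    apply: fintype.subset_trans (finset.subD1set B e).
    by rewrite -(_ : w :\ e = w) //; apply/finset.setDidPl; rewrite disjoint_sym finset.disjoints1 ew.
  rewrite G's ?mul0r //; apply: contra wB => wB; apply/fintype.subsetP => f fw.
  have [->//|fe] := eqVneq f e; have := fintype.subsetP wB f.
  by rewrite !inE fe fw => /(_ isT).
move=> w; rewrite !(sum_subsets _ eU).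
have mS : \sum_(C : {set {set V}} | C \subset U :\ e) (mu C + mu (e |: C)) =
  \sum_(C : {set {set V}} | C \subset U :\ e) m C by [].
rewrite mS.
have term C : C \subset U :\ e ->
    G' (C :\ e) (w :\ e) / m (C :\ e) * joint C w +
    G' ((e |: C) :\ e) (w :\ e) / m ((e |: C) :\ e) * joint (e |: C) w =
    (if e \in w then p else 1 - p) * G' C (w :\ e).
  move=> CU'; have eC : e \notin C by move: CU'; rewrite finset.subsetD1 => /andP[].
  have Ce : C :\ e = C by apply/finset.setDidPl; rewrite disjoint_sym finset.disjoints1.
  rewrite finset.setU1K // Ce -mulrDr /joint finset.setU11 (negPf eC) finset.setU1K //.
  case: ifP => _.
    by rewrite add0r mulrCA G'mm.
  by rewrite addrA -/(m C) (_ : m C - p * m C = (1 - p) * m C); [rewrite mulrCA G'mm | rewrite mulrBl mul1r].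
rewrite (eq_bigr _ term) -mulr_sumr G'b mulrA; congr (_ * _).
case: ifP => ew; first by rewrite (bernoulli_perc_in p eU ew).
rewrite (bernoulli_perc_out p eU (negbT ew)); congr (_ * bernoulli_perc _ _ _).
by apply/finset.setDidPl; rewrite disjoint_sym finset.disjoints1 ew.
Qed.

End Coupling.

(** * Passage to infinite sums *)

Section Limit.
Variable V : finType.
Implicit Types (a c z : config V) (e f g h : {set V}) (U b B : {set {set V}}) (n : nat).
Variables (R : realType) (beta u theta : R).
Hypotheses (hbeta : 0 < beta) (htheta : 0 < theta) (hu0 : 0 < u) (hu1 : u <= 1).

Local Notation W := (loop_weight beta u theta).
Local Notation y := (beta * Num.max theta theta^-1).
Local Notation SW n P := (\sum_(c <- configs_lt V n | P c) W c).
Let W0 (c : config V) : 0 <= W c := loop_weight_ge0 hbeta htheta hu0 hu1 c.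
Let y0 : 0 < y := rate_gt0 hbeta htheta.

(** Erasing the edges of [U] one after the other costs a factor e^y - 1 each and ends at the empty
    configuration. *)
Lemma cond_sum_bounded U : (forall e, e \in U -> #|e| = 2%N) ->
  exists M, forall n, SW n (cond_event U) <= M.
Proof.
move Uk : #|U| => k; elim: k U Uk => [|k IH] U Uk U2.
  exists (W ([::] : config V)) => n; have U0 : U = finset.set0 by apply/eqP; rewrite -cards_eq0 Uk.
  have nil c : cond_event U c -> c = [::].
    by case: c => // l c /andP[/andP[+ _] _]; rewrite U0 inE.
  rewrite -big_filter; case E: [seq c <- configs_lt V n | cond_event U c] => [|c s]; first by rewrite big_nil.
  have us : uniq (c :: s) by rewrite -E filter_uniq ?configs_lt_uniq.
  have all_nil c' : c' \in c :: s -> c' = [::] by rewrite -E mem_filter => /andP[/nil].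
  have s0 : s = [::].
    case: s us all_nil {E} => // c' s /andP[+ _] h.
    by rewrite (h c) ?mem_head // -(h c') ?mem_head // !inE eqxx orbT.
  by rewrite s0 big_cons big_nil addr0 (all_nil c) ?mem_head.
have /finset.set0Pn[e eU] : U != finset.set0 by rewrite -card_gt0 Uk.
have Uk' : #|U :\ e| = k by move: Uk; rewrite (cardsD1 e) eU => -[].
have U2' g : g \in U :\ e -> #|g| = 2%N by rewrite inE => /andP[_ /U2].
have [M hM] := IH _ Uk' U2'; exists ((expR y - 1) * M) => n.
have X0 : 0 <= expR y - 1 by rewrite subr_ge0 -[leLHS]expR0 ler_expR ltW.
have simp c : cond_event (U :\ e) c -> simple c.
  by move=> /andP[/allP cU _]; apply/allP => l /cU /U2' ->.
apply: le_trans (ler_wpM2l X0 (hM n)).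
apply: le_trans (erase_sum hbeta htheta hu0 hu1 n (U2 _ eU) simp).
apply: weight_sum_sub => // c /andP[/allP cU /forall_inP cN]; rewrite (cN e eU) andbT.
apply/andP; split; first by apply/allP => l; rewrite mem_filter !inE => /andP[-> /cU].
by apply/forall_inP => g; rewrite !inE => /andP[ge gU]; rewrite Nlinks_erase ?cN.
Qed.

Variable U : {set {set V}}.
Hypothesis U2 : forall e, e \in U -> #|e| = 2%N.

Definition mass (P : pred (config V)) : R := limn (fun n => SW n P).

Lemma weight_sum_nondecreasing (P : pred (config V)) n m : (n <= m)%N -> SW n P <= SW m P.
Proof.
move=> nm; apply: (@ler_sum_inj _ _ _ _ _ _ _ _ _ id).
- exact: configs_lt_uniq.
- exact: configs_lt_uniq.
- by move=> c cn Pc; split => //; move: cn; rewrite !mem_configs_lt => /leq_trans -> //.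
- by [].
- by move=> c _; exact: W0.
Qed.

Section Sub.
Variable P : pred (config V).
Hypothesis PU : forall c, P c -> cond_event U c.

Lemma weight_sum_cvg : cvgn (fun n => SW n P).
Proof.
have [M hM] := cond_sum_bounded U2.
apply: nondecreasing_is_cvgn; first by move=> n m; exact: weight_sum_nondecreasing.
exists M => _ [n _ <-]; apply: le_trans (hM n); exact: weight_sum_sub.
Qed.

Lemma weight_sum_le_mass n : SW n P <= mass P.
Proof.
by apply: (nondecreasing_cvgn_le _ weight_sum_cvg) => m k; exact: weight_sum_nondecreasing.
Qed.

Lemma mass_ge0 : 0 <= mass P.
Proof. by apply: le_trans (weight_sum_le_mass 0); apply: sumr_ge0. Qed.

Lemma loop_weight_le_mass c : P c -> W c <= mass P.
Proof.
move=> Pc; apply: le_trans (weight_sum_le_mass (size c).+1).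
rewrite big_mkcond (bigD1_seq c) ?configs_lt_uniq ?mem_configs_lt //= Pc lerDl.
by apply: sumr_ge0 => c' _; case: ifP.
Qed.

End Sub.

Definition blocked_set c := [set e in U | blocking c e].

Lemma outcome_blocked_set B c : B \subset U ->
  outcome U U B c = cond_event U c && (B == blocked_set c).
Proof.
move=> BU; rewrite /outcome; congr (_ && _); apply/forall_inP/eqP => [h|-> e eU]; last first.
  by rewrite inE eU.
apply/finset.setP => e; rewrite inE; case: (boolP (e \in U)) => eU /=.
  by rewrite -(eqP (h e eU)).
by apply/negbTE; apply: contra eU => /(fintype.subsetP BU).
Qed.

Lemma outcome_cond B c : outcome U U B c -> cond_event U c.
Proof. by case/andP. Qed.

Lemma sum_by_blocked n (F : config V -> {set {set V}} -> R) :
  \sum_(c <- configs_lt V n | cond_event U c) F c (blocked_set c) =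
  \sum_(B : {set {set V}} | B \subset U) \sum_(c <- configs_lt V n | outcome U U B c) F c B.
Proof.
under [RHS]eq_bigr => B BU do (under eq_bigl => c do rewrite (outcome_blocked_set c BU)).
rewrite [RHS](exchange_big_dep (cond_event U)) /=; last by move=> B c _ /andP[].
apply: eq_bigr => c cU; rewrite (big_pred1 (blocked_set c)) // => B /=.
rewrite cU /=; case: eqP => [->|_]; last by rewrite andbF.
by rewrite andbT; apply/fintype.subsetP => e; rewrite inE => /andP[].
Qed.

Lemma mass_cond : mass (cond_event U) =
  \sum_(B : {set {set V}} | B \subset U) mass (outcome U U B).
Proof.
apply: cvg_lim => //.
have -> : (fun n => SW n (cond_event U)) =
    (fun n => \sum_(B : {set {set V}} | B \subset U) SW n (outcome U U B)).
  by apply: funext => n; rewrite -(sum_by_blocked n (fun c _ => W c)).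
apply: cvg_big => [|B _]; first exact: add_continuous.
exact: weight_sum_cvg (@outcome_cond B).
Qed.

Lemma mass_cond_gt0 : 0 < mass (cond_event U).
Proof.
(* One cross per edge: without double bars the weight is positive even for [u] = 1. *)
pose c : config V := [seq (e, true) | e <- enum U].
have cU : cond_event U c.
  apply/andP; split; first by apply/allP => _ /mapP[e + ->]; rewrite mem_enum.
  apply/forall_inP => e eU; rewrite -has_count; apply/hasP; exists (e, true) => //=.
  by apply: map_f; rewrite mem_enum.
apply: lt_le_trans (loop_weight_le_mass _ cU) => //.
have c0 : count (fun l : link V => ~~ l.2) c = 0%N.
  by rewrite count_map; apply/eqP; rewrite -leqn0 leqNgt -has_count; apply/hasPn.
rewrite /loop_weight c0 expr0 mulr1 !mulr_gt0 ?exprn_gt0 //.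
Qed.

Variables (E : {set {set V}}) (K : nat).
Hypothesis hE : forall e, e \in E -> #|e| = 2%N.
Hypothesis hdeg : forall v : V, (#|[set e in E | v \in e]| <= K)%N.
Hypothesis UE : U \subset E.

Lemma mass_step e (C : {set {set V}}) : e \in U -> C \subset U :\ e ->
  delta_const K beta u theta * (mass (outcome U U C) + mass (outcome U U (e |: C))) <=
  mass (outcome U U (e |: C)).
Proof.
move=> eU CU; have CU' : C \subset U by apply: fintype.subset_trans CU _; exact: finset.subD1set.
have eC : e \notin C by apply/negP => /(fintype.subsetP CU); rewrite !inE eqxx.
(* Only the left side stays truncated; bounding the right one by its mass absorbs the shift from [n]
   to [n.+2]. *)
have step n : delta_const K beta u theta *
    (SW n (outcome U U C) + SW n (outcome U U (e |: C))) <= mass (outcome U U (e |: C)).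
  have U'E : U :\ e \subset E by apply: fintype.subset_trans UE; exact: finset.subD1set.
  have eU' : e \notin U :\ e by rewrite !inE eqxx.
  have := blocking_step hE hdeg hbeta htheta hu0 hu1 U'E CU (fintype.subsetP UE _ eU) eU' n.
  rewrite finset.setD1K // => h; apply: le_trans (weight_sum_le_mass (@outcome_cond _) n.+2).
  apply: le_trans h; rewrite le_eqVlt; apply/orP; left; apply/eqP; congr (_ * _).
  rewrite [in RHS](bigID (fun c => blocking c e)) /= [LHS]addrC; congr (_ + _); apply: eq_bigl => c.
    rewrite /outcome -andbA; congr (_ && _).
    apply/forall_inP/andP => [h|[/forall_inP h be] g gU].
      split; last by have := h e eU; rewrite !inE eqxx => /eqP.
      apply/forall_inP => g; rewrite !inE => /andP[ge gU].
      by have := h g gU; rewrite !inE (negPf ge).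
    have [->|ge] := eqVneq g e; first by rewrite be finset.setU11.
    by have := h g; rewrite !inE gU (negPf ge) /= => /(_ isT).
  rewrite /outcome -andbA; congr (_ && _).
  apply/forall_inP/andP => [h|[/forall_inP h be] g gU].
    split; last by have := h e eU; rewrite (negPf eC) => /eqP ->.
    by apply/forall_inP => g; rewrite !inE => /andP[ge gU]; exact: h.
  have [->|ge] := eqVneq g e; first by rewrite (negPf be) (negPf eC).
  by have := h g; rewrite !inE ge gU => /(_ isT).
pose dn n := delta_const K beta u theta *
    (SW n (outcome U U C) + SW n (outcome U U (e |: C))).
set d := delta_const K beta u theta * _; have cv : (dn @ \oo --> d)%classic.
  apply: cvgMl_tmp; apply: cvgD; exact: weight_sum_cvg (@outcome_cond _).
rewrite -(cvg_lim (@norm_hausdorff _ _) cv); apply: limr_le; first by apply: cvgP cv.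
by apply: nearW.
Qed.

End Limit.

(** * The coupling on configurations *)

Local Open Scope classical_set_scope.

Theorem theorem1p1 (V : finType) (E : {set {set V}}) (K : nat)
  (R : realType) (beta u theta : R)
  (hE : forall e, e \in E -> #|e| = 2%N)
  (hdeg : forall v : V, (#|[set e in E | v \in e]| <= K)%N)
  (hbeta : 0 < beta) (htheta : 0 < theta) (hu0 : 0 < u) (hu1 : u <= 1)
  (Et : {set {set V}}) (hEt : Et \subset E) :
  exists q : config V -> {set {set V}} -> R,
    [/\ forall c w, 0 <= q c w,
        forall c, \sum_(w : {set {set V}}) q c w = cond_loop_prob beta u theta Et c,
        forall w, series (fun n => \sum_(c : n.-tuple (link V)) q c w) @ \oo
                    --> bernoulli_perc (delta_const K beta u theta) Et w
      & forall c w, 0 < q c w -> forall e, e \in w -> (e \in Et) && blocking c e].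
Proof.
have Et2 e : e \in Et -> #|e| = 2%N by move=> /(fintype.subsetP hEt); exact: hE.
set p := delta_const K beta u theta.
have pb : 0 <= p <= 1.
  (* For K = 0 the division by zero makes [delta_const] vanish. *)
  rewrite /p; case: (posnP K) => [->|K0]; last exact: delta_const_bounds.
  by rewrite /delta_const invr0 mulr0 expr0n mulr0 !mul0r lexx ler01.
pose mu B := mass beta u theta (outcome Et Et B).
have mu0 B : 0 <= mu B by apply: (mass_ge0 hbeta htheta hu0 hu1 Et2) => c; exact: outcome_cond.
have [G [G0 Gm Gs Gb]] := bernoulli_coupling pb (fun B _ => mu0 B)
  (fun e C => mass_step hbeta htheta hu0 hu1 Et2 hE hdeg hEt (e := e) (C := C)).
pose W := @loop_weight V R beta u theta.
pose L := mass beta u theta (cond_event Et).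
have L0 : 0 < L by apply: mass_cond_gt0.
have W0 c : 0 <= W c by exact: loop_weight_ge0.
have seriesE (F : config V -> R) : series (fun n => \sum_(c : n.-tuple (link V)) F c) =
    (fun n => \sum_(c <- configs_lt V n) F c).
  by apply: funext => n; rewrite big_configs_lt.
have LE : sum_configs (fun c => W c * (cond_event Et c)%:R) = L.
  rewrite /sum_configs (seriesE (fun c => W c * (cond_event Et c)%:R)); congr (limn _); apply: funext => n.
  by rewrite [RHS]big_mkcond; apply: eq_bigr => c _; case: cond_event; rewrite ?mulr1 ?mulr0.
have probE c : cond_loop_prob beta u theta Et c = (if cond_event Et c then W c else 0) / L.
  by rewrite /cond_loop_prob LE; case: cond_event; rewrite ?mulr1 ?mulr0.
pose bs c := blocked_set Et c.
have bsE c : bs c \subset Et by apply/fintype.subsetP => e; rewrite inE => /andP[].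
(* Given the configuration, [w] follows the conditional law of the coupling [G] given the set of
   blocking edges. *)
pose q c w := cond_loop_prob beta u theta Et c * (G (bs c) w / mu (bs c)).
have prob0 c : 0 <= cond_loop_prob beta u theta Et c.
  by rewrite probE; apply: divr_ge0; [case: ifP | exact: ltW].
exists q; split.
- by move=> c w; apply: mulr_ge0 => //; apply: divr_ge0 => //; exact: G0.
- move=> c; rewrite /q -mulr_sumr -mulr_suml Gm //.
  (* A blocked set of mass zero forces the weight of [c] itself to be zero, so both sides vanish. *)
  have [mz|mz] := eqVneq (mu (bs c)) 0; last by rewrite divff ?mulr1.
  rewrite mz mul0r mulr0 probE; case: ifP => cU; last by rewrite mul0r.
  have oc : outcome Et Et (bs c) c by rewrite outcome_blocked_set // cU eqxx.
  have := loop_weight_le_mass hbeta htheta hu0 hu1 Et2 (@outcome_cond _ _ _) oc.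
  rewrite -/(mu _) mz -/(W c) => Wc; have -> : W c = 0 by apply/eqP; rewrite eq_le Wc W0.
  by rewrite mul0r.
- move=> w; rewrite (seriesE (fun c => q c w)).
  have -> : (fun n => \sum_(c <- configs_lt V n) q c w) = (fun n =>
      \sum_(B : {set {set V}} | B \subset Et)
        (\sum_(c <- configs_lt V n | outcome Et Et B c) W c) * (G B w / (mu B * L))).
    apply: funext => n.
    under [RHS]eq_bigr do rewrite mulr_suml.
    rewrite -(sum_by_blocked Et n (fun c B => W c * (G B w / (mu B * L)))) [RHS]big_mkcond.
    apply: eq_bigr => c _; rewrite /q probE -/(bs c); case: ifP => _; last by rewrite !mul0r.
    by rewrite invfM mulrAC -!mulrA; congr (_ * _); rewrite mulrCA mulrC -mulrA mulrC mulrA.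
  have -> : bernoulli_perc p Et w =
      \sum_(B : {set {set V}} | B \subset Et) mu B * (G B w / (mu B * L)).
    have -> : bernoulli_perc p Et w = (\sum_(B : {set {set V}} | B \subset Et) G B w) / L.
      by rewrite Gb -(mass_cond hbeta htheta hu0 hu1 Et2) mulfK // lt0r_neq0.
    rewrite mulr_suml; apply: eq_bigr => B BU.
    have [mz|mz] := eqVneq (mu B) 0; last by field; rewrite mz lt0r_neq0.
    rewrite mz !mul0r; apply/eqP; rewrite mulf_eq0; apply/orP; left.
    have := Gm B BU; rewrite mz => /eqP; rewrite psumr_eq0; last by move=> v _; exact: G0.
    by move=> /allP/(_ w (mem_index_enum _)).
  apply: cvg_big => [|B BU]; first exact: add_continuous.
  by apply: cvgMr_tmp; apply: (weight_sum_cvg hbeta htheta hu0 hu1 Et2); exact: outcome_cond.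
- move=> c w qw e ew; have /fintype.subsetP/(_ e ew) : w \subset bs c.
    by apply: contraLR qw => /(Gs _ _ (bsE c)) Gz; rewrite /q Gz mul0r mulr0 ltxx.
  by rewrite inE.
Qed.
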